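(* Let $d\ge1$ and let $V_{\omega_1}\cong\mathbb{C}(q)^d$ be the standard $U_q(gl_d(\mathbb{C}))$-module. Then $V_{\omega_1}$ is flat. More precisely: (a) Each graded component $S_\sigma(V_{\omega_1})_n$ of the braided symmetric algebra is irreducible and isomorphic to $V_{n\omega_1}$. (b) As an algebra, $S_\sigma(V_{\omega_1})$ is isomorphic to the $q$-polynomial algebra $\mathbb{C}_q[x_1,\ldots,x_d]$, i.e. the $\mathbb{C}(q)$-algebra generated by $x_1,\ldots,x_d$ subject to the relations $x_jx_i=qx_ix_j$ for $1\le i<j\le d$.
   Context: $U_q(gl_d(\mathbb{C}))$: $P=\mathbb{Z}^d$ with standard inner product $(\cdot|\cdot)$ and standard basis $e_1,\dots,e_d$, $\alpha_i=e_i-e_{i+1}$ ($1\le i\le d-1$). It is the $\mathbb{C}(q)$-algebra generated by $E_i,F_i$ ($1\le i\le d-1$), $K_\lambda$ ($\lambda\in P$) with $K_\lambda K_\mu=K_{\lambda+\mu}$, $K_0=1$, $K_\lambda E_i=q^{(\alpha_i|\lambda)}E_iK_\lambda$, $K_\lambda F_i=q^{-(\alpha_i|\lambda)}F_iK_\lambda$, $E_iF_j-F_jE_i=\delta_{ij}\frac{K_{\alpha_i}-K_{-\alpha_i}}{q-q^{-1}}$ and the quantum Serre relations; coproduct $\Delta(E_i)=E_i\otimes 1+K_{\alpha_i}\otimes E_i$, $\Delta(F_i)=F_i\otimes K_{-\alpha_i}+1\otimes F_i$, $\Delta(K_\lambda)=K_\lambda\otimes K_\lambda$. $\mathcal{O}_f$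 is the category of finite-dimensional modules $V=\bigoplus_{\mu\in P}V(\mu)$ with $K_\lambda$ acting on $V(\mu)$ by $q^{(\lambda|\mu)}$. Its simple objects are $V_\lambda$, $\lambda=(\lambda_1\ge\dots\ge\lambda_d)\in\mathbb{Z}^d$ the highest weight; $\omega_1=(1,0,\dots,0)$. The braiding is $\mathcal{R}_{U,V}=\tau\circ R$, where $\tau$ is the permutation of factors and $R=R_0R_1$ is the universal $R$-matrix ($R\Delta=\Delta^{op}R$), $R_0(u\otimes v)=q^{(\lambda|\mu)}u\otimes v$ for $u,v$ of weights $\lambda,\mu$, $R_1\in 1\otimes1+\widehat{\bigoplus}_{k\ge1}U^-_k\otimes U^+_k$ ($U^\mp$ generated by the $F_i$, resp. the $E_i$, graded by number of generators). $\mathcal{R}_{V,V}$ is diagonalizable with eigenvalues $\pm q^k$, $k\in\mathbb{Z}$; $S^2_\sigma V$ (resp. $\Lambda^2_\sigma V$) is the span in $V\otimes V$ of eigenvectors with eigenvalues $+q^k$ (resp. $-q^k$). $S_\sigma(V)=T(V)/\langle\Lambda^2_\sigma V\rangle$, graded by tensor degree. For $n\ge2$, $S^n_\sigma V=\bigcap_{i=1}^{n-1}V^{\otimes(i-1)}\otimes S^2_\sigma V\otimes V^{\otimes(n-1-i)}\subset V^{\otimes n}$; $S^0_\sigma V=\mathbb{C}(q)$, $S^1_\sigma V=V$. $V$ is flat if $\dim S^n_\sigma V=\binom{\dim V+n-1}{n}$ for all $n\ge0$. *)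

(* Defs.v *)
From HB Require Import structures.
From mathcomp Require Import all_boot all_order all_algebra.
From mathcomp Require Import generic_quotient ring_quotient.
From mathcomp Require Import complex finmap monalg.
From mathcomp Require Import boolp classical_sets reals.

Set Implicit Arguments.
Unset Strict Implicit.
Unset Printing Implicit Defensive.

Import GRing.Theory.
Local Open Scope ring_scope.
Local Open Scope classical_set_scope.
Local Open Scope quotient_scope.

(* The field C(q), for R any model of the real numbers, and its generator. *)
Definition Cq (R : realType) : fieldType := {fraction {poly R[i]}}.
Definition qvar (R : realType) : Cq R := tofrac 'X.

Section LinearSpan.
Variables (K : fieldType) (M : lmodType K).

Definition lspan (A : set M) : set M :=
  [set x | exists2 s : seq (K * M), (forall t, t \in s -> A t.2) &
                                    x = \sum_(t <- s) t.1 *: t.2].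

Definition has_dim (N : set M) (m : nat) : Prop :=
  exists2 b : 'I_m -> M,
    forall c : 'I_m -> K, \sum_i c i *: b i = 0 -> forall i, c i = 0 &
    forall x, N x <-> exists c : 'I_m -> K, x = \sum_i c i *: b i.

Lemma lspan0 (A : set M) : lspan A 0.
Proof. by exists [::] => //; rewrite big_nil. Qed.

Lemma lspanD (A : set M) x y : lspan A x -> lspan A y -> lspan A (x + y).
Proof.
move=> [s sA ->] [t tA ->]; exists (s ++ t); last by rewrite big_cat.
by move=> u; rewrite mem_cat => /orP[/sA|/tA].
Qed.

Lemma lspanZ (A : set M) k x : lspan A x -> lspan A (k *: x).
Proof.
move=> [s sA ->]; exists [seq (k * t.1, t.2) | t <- s].
  by move=> u /mapP[t ts ->]; exact: (sA _ ts).
by rewrite big_map scaler_sumr; apply: eq_bigr => t _; rewrite scalerA.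
Qed.

End LinearSpan.

(* {malg K[{fmonom I}]}, the monoid algebra of the free monoid on I, is the   *)
(* free associative K-algebra on I.                                           *)
Notation freealg K I := {malg K[{fmonom I}]}.
Definition word (K : fieldType) (I : choiceType) (w : seq I) : freealg K I :=
  << FMonom w >>.
Definition gen (K : fieldType) (I : choiceType) (i : I) : freealg K I :=
  word K [:: i].

Section QuotientAlgebra.
Variables (K : fieldType) (I : choiceType).
Local Notation T := (freealg K I).

(* The two-sided ideal generated by G. *)
Definition ideal_set (G : set T) : set T :=
  lspan [set x | exists a g b, G g /\ x = a * g * b].

Definition ideal (G : set T) : pred T := fun x => `[< ideal_set G x >].

Lemma idealP G x : reflect (ideal_set G x) (x \in ideal G).
Proof. exact: asboolP. Qed.

Lemma ideal_addr_closed G : addr_closed (ideal G).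
Proof.
split=> [|x y /idealP ? /idealP ?]; apply/idealP; first exact: lspan0.
exact: lspanD.
Qed.

Lemma ideal_oppr_closed G : oppr_closed (ideal G).
Proof. by move=> x /idealP ?; apply/idealP; rewrite -scaleN1r; exact: lspanZ. Qed.

HB.instance Definition _ G := GRing.isAddClosed.Build T (ideal G)
  (@ideal_addr_closed G).
HB.instance Definition _ G := GRing.isOppClosed.Build T (ideal G)
  (@ideal_oppr_closed G).

Lemma idealZ G k x : x \in ideal G -> k *: x \in ideal G.
Proof. by move=> /idealP ?; apply/idealP/lspanZ. Qed.

Lemma scale_mulr k (x y : T) : x * (k *: y) = k *: (x * y).
Proof.
have -> : k *: y = k%:MP * y by rewrite mul_malgC.
have -> : k *: (x * y) = k%:MP * (x * y) by rewrite mul_malgC.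
rewrite !mulrA; congr (_ * _); rewrite !malgM_def fgmulgU fgmulUg.
by apply: eq_bigr => w _; rewrite mulm1 mul1m mulrC.
Qed.

Lemma idealMl G a x : x \in ideal G -> a * x \in ideal G.
Proof.
move=> /idealP[s sG ->]; apply/idealP.
exists [seq (t.1, a * t.2) | t <- s].
  move=> u /mapP[t ts ->] /=; have [b [g [c [Gg ->]]]] := sG _ ts.
  by exists (a * b), g, c; rewrite !mulrA.
by rewrite big_map mulr_sumr; apply: eq_bigr => t _; rewrite scale_mulr.
Qed.

Lemma idealMr G a x : x \in ideal G -> x * a \in ideal G.
Proof.
move=> /idealP[s sG ->]; apply/idealP.
exists [seq (t.1, t.2 * a) | t <- s].
  move=> u /mapP[t ts ->] /=; have [b [g [c [Gg ->]]]] := sG _ ts.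
  by exists b, g, (c * a); rewrite !mulrA.
by rewrite big_map mulr_suml; apply: eq_bigr => t _; rewrite scalerAl.
Qed.

(* The K-algebra with generators I and relations G, as a ring that is also a  *)
(* K-module: lalgType would require a proof that 1 is not in the ideal.       *)
Definition quotalg (G : set T) : Type := Quotient.quot (GRing.ZmodClosed.clone T (ideal G) _).

HB.instance Definition _ G := GRing.Zmodule.on (quotalg G).
HB.instance Definition _ G := EqQuotient.on (quotalg G).

Definition quot_proj (G : set T) (x : T) : quotalg G := \pi_(quotalg G) x.

Section Structure.
Variable G : set T.
Local Notation Q := (quotalg G).
Local Notation pi := (@quot_proj G).

Lemma quot_projP x y : reflect (pi x = pi y) (x - y \in ideal G).
Proof. by rewrite Quotient.idealrBE; exact: eqP. Qed.

Lemma repr_proj (x : Q) : pi (repr x) = x.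
Proof. exact: reprK. Qed.

Lemma quot_projD x y : pi (x + y) = pi x + pi y.
Proof. exact: Quotient.pi_add. Qed.

Definition quot_one : Q := pi 1.
Definition quot_mul (x y : Q) : Q := pi (repr x * repr y).
Definition quot_scale (k : K) (x : Q) : Q := pi (k *: repr x).

Lemma quot_projM x y : pi (x * y) = quot_mul (pi x) (pi y).
Proof.
apply/quot_projP.
rewrite -[x * y](subrK (repr (pi x) * y)) -addrA -mulrBl -mulrBr rpredD//.
  by apply: idealMr; apply/quot_projP; rewrite repr_proj.
by apply: idealMl; apply/quot_projP; rewrite repr_proj.
Qed.

Lemma quot_projZ k x : pi (k *: x) = quot_scale k (pi x).
Proof.
by apply/quot_projP; rewrite -scalerBr idealZ//; apply/quot_projP; rewrite repr_proj.
Qed.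

Fact quot_mulA : associative quot_mul.
Proof.
move=> x y z; rewrite -[x]repr_proj -[y]repr_proj -[z]repr_proj.
by rewrite -!quot_projM mulrA.
Qed.

Fact quot_mul1 : left_id quot_one quot_mul.
Proof. by move=> x; rewrite -[x]repr_proj -quot_projM mul1r. Qed.

Fact quot_1mul : right_id quot_one quot_mul.
Proof. by move=> x; rewrite -[x]repr_proj -quot_projM mulr1. Qed.

Fact quot_mulDl : left_distributive quot_mul +%R.
Proof.
move=> x y z; rewrite -[x]repr_proj -[y]repr_proj -[z]repr_proj.
by rewrite -quot_projD -!quot_projM -quot_projD mulrDl.
Qed.

Fact quot_mulDr : right_distributive quot_mul +%R.
Proof.
move=> x y z; rewrite -[x]repr_proj -[y]repr_proj -[z]repr_proj.
by rewrite -quot_projD -!quot_projM -quot_projD mulrDr.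
Qed.

HB.instance Definition _ := GRing.Zmodule_isPzRing.Build Q
  quot_mulA quot_mul1 quot_1mul quot_mulDl quot_mulDr.

Fact quot_scaleA a b (x : Q) : quot_scale a (quot_scale b x) = quot_scale (a * b) x.
Proof. by rewrite -[x]repr_proj -!quot_projZ scalerA. Qed.

Fact quot_scale1 : left_id 1 quot_scale.
Proof. by move=> x; rewrite -[x]repr_proj -quot_projZ scale1r. Qed.

Fact quot_scaleDr : right_distributive quot_scale +%R.
Proof.
move=> k x y; rewrite -[x]repr_proj -[y]repr_proj.
by rewrite -quot_projD -!quot_projZ -quot_projD scalerDr.
Qed.

Fact quot_scaleDl (x : Q) : {morph quot_scale^~ x : a b / a + b}.
Proof.
by move=> a b; rewrite -[x]repr_proj -!quot_projZ -quot_projD scalerDl.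
Qed.

HB.instance Definition _ := GRing.Zmodule_isLmodule.Build K Q
  quot_scaleA quot_scale1 quot_scaleDr quot_scaleDl.

End Structure.
End QuotientAlgebra.

Section QuantumGL.
Variables (K : fieldType) (q : K) (d : nat).

(* The weight lattice P = Z^d.  Indices are shifted down by one: the simple   *)
(* root alpha i, for i < d - 1, is e_i - e_(i+1) in 0-based numbering.        *)
Definition weight := 'rV[int]_d.
Definition pairing (l m : weight) : int := \sum_j l 0 j * m 0 j.
Definition alpha (i : 'I_d.-1) : weight :=
  \row_j ((j == i :> nat)%:Z - (j == i.+1 :> nat)%:Z).
Definition omega1 : weight := \row_j (j == 0 :> nat)%:Z.

(* A module over U_q(gl_d), an algebra given by generators and relations, is  *)
(* a vector space with operators for the generators satisfying the relations. *)
Record Uq_action (M : lmodType K) := UqAction {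
  actE : 'I_d.-1 -> M -> M;
  actF : 'I_d.-1 -> M -> M;
  actK : weight -> M -> M }.

Record is_Uq_module (M : lmodType K) (a : Uq_action M) : Prop := IsUqModule {
  Uq_linE : forall i, linear (actE a i);
  Uq_linF : forall i, linear (actF a i);
  Uq_linK : forall l, linear (actK a l);
  Uq_K0 : forall v, actK a 0 v = v;
  Uq_KD : forall l m v, actK a l (actK a m v) = actK a (l + m) v;
  Uq_KE : forall l i v,
    actK a l (actE a i v) = q ^ pairing (alpha i) l *: actE a i (actK a l v);
  Uq_KF : forall l i v,
    actK a l (actF a i v) = q ^ (- pairing (alpha i) l) *: actF a i (actK a l v);
  Uq_EF : forall i j v,
    actE a i (actF a j v) - actF a j (actE a i v) =
    ((i == j)%:R / (q - q^-1)) *: (actK a (alpha i) v - actK a (- alpha i) v);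
  (* Serre relations, for |i - j| > 1 and for |i - j| = 1 *)
  Uq_SerreE0 : forall i j v, pairing (alpha i) (alpha j) = 0 ->
    actE a i (actE a j v) = actE a j (actE a i v);
  Uq_SerreE1 : forall i j v, pairing (alpha i) (alpha j) = -1 ->
    actE a i (actE a i (actE a j v))
    - (q + q^-1) *: actE a i (actE a j (actE a i v))
    + actE a j (actE a i (actE a i v)) = 0;
  Uq_SerreF0 : forall i j v, pairing (alpha i) (alpha j) = 0 ->
    actF a i (actF a j v) = actF a j (actF a i v);
  Uq_SerreF1 : forall i j v, pairing (alpha i) (alpha j) = -1 ->
    actF a i (actF a i (actF a j v))
    - (q + q^-1) *: actF a i (actF a j (actF a i v))
    + actF a j (actF a i (actF a i v)) = 0 }.

Definition equivariant (M M' : lmodType K) (a : Uq_action M) (a' : Uq_action M')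
    (f : M -> M') : Prop :=
  [/\ forall i v, f (actE a i v) = actE a' i (f v),
      forall i v, f (actF a i v) = actF a' i (f v) &
      forall l v, f (actK a l v) = actK a' l (f v)].

Section Modules.
Variables (M : lmodType K) (a : Uq_action M).

Definition submodule (N : set M) : Prop :=
  [/\ N 0, forall k u v, N u -> N v -> N (k *: u + v),
      forall i v, N v -> N (actE a i v),
      forall i v, N v -> N (actF a i v) &
      forall l v, N v -> N (actK a l v)].

Definition weight_vector (m : weight) (v : M) : Prop :=
  forall l, actK a l v = q ^ pairing l m *: v.

(* The submodule N is an object of O_f.  The sum of the weight spaces is      *)
(* automatically direct when q is not a root of unity.                        *)
Definition in_Of (N : set M) : Prop :=
  [/\ submodule N, exists m, has_dim N m &
      forall v, N v -> lspan [set u | N u /\ exists m, weight_vector m u] v].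

Definition irreducible (N : set M) : Prop :=
  [/\ submodule N, exists2 v, N v & v <> 0 &
      forall N', submodule N' -> N' `<=` N -> N' = [set 0] \/ N' = N].

Definition has_highest_weight (N : set M) (l : weight) : Prop :=
  exists v, [/\ N v, v <> 0, weight_vector l v & forall i, actE a i v = 0].

(* N is a model of the simple object V_l of O_f. *)
Definition simple_of_hw (N : set M) (l : weight) : Prop :=
  [/\ in_Of N, irreducible N & has_highest_weight N l].

End Modules.

(* The module (M, a) is isomorphic to the submodule N of (M', a'). *)
Definition isomorphic_to (M M' : lmodType K) (a : Uq_action M)
    (a' : Uq_action M') (N : set M') : Prop :=
  exists f : M -> M',
    [/\ linear f, injective f, equivariant a a' f & range f = N].

(* K^m (x) K^n is 'M_(m, n), with u (x) v := u^T *m v; the flip of the two    *)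
(* factors is then the transposition of matrices.                             *)
Definition tens m n (f : 'rV[K]_m -> 'rV[K]_m) (g : 'rV[K]_n -> 'rV[K]_n)
    (X : 'M[K]_(m, n)) : 'M[K]_(m, n) := (lin1_mx f)^T *m X *m lin1_mx g.

Section Tensor.
Variables (m n : nat) (a : Uq_action 'rV[K]_m) (b : Uq_action 'rV[K]_n).

Definition tens_action : Uq_action 'M[K]_(m, n) := UqAction
  (fun i X => tens (actE a i) id X + tens (actK a (alpha i)) (actE b i) X)
  (fun i X => tens (actF a i) (actK b (- alpha i)) X + tens id (actF b i) X)
  (fun l X => tens (actK a l) (actK b l) X).

Definition tens_action_op : Uq_action 'M[K]_(m, n) := UqAction
  (fun i X => tens id (actE b i) X + tens (actE a i) (actK b (alpha i)) X)
  (fun i X => tens (actK a (- alpha i)) (actF b i) X + tens (actF a i) id X)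
  (fun l X => tens (actK a l) (actK b l) X).

End Tensor.

(* An element of the completed direct sum of the U^-_k (x) U^+_k, written as  *)
(*   \sum_k \sum_(I, J) Theta k I J F_I (x) E_J                               *)
(* where I and J run through the words of length k.                           *)
Definition R_series :=
  forall k : nat, k.-tuple 'I_d.-1 -> k.-tuple 'I_d.-1 -> K.

Section RMatrix.
Variables (Theta : R_series) (m n : nat).
Variables (a : Uq_action 'rV[K]_m) (b : Uq_action 'rV[K]_n).

Definition R1_term (k : nat) (X : 'M[K]_(m, n)) : 'M[K]_(m, n) :=
  \sum_(I : k.-tuple 'I_d.-1) \sum_(J : k.-tuple 'I_d.-1)
    Theta I J *: tens (fun u => foldr (actF a) u I)
                      (fun v => foldr (actE b) v J) X.

Definition is_R0 (R0 : 'M[K]_(m, n) -> 'M[K]_(m, n)) : Prop :=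
  linear R0 /\
  forall l l' u v, weight_vector a l u -> weight_vector b l' v ->
    R0 (u^T *m v) = q ^ pairing l l' *: (u^T *m v).

(* On modules of O_f all but finitely many terms of the series vanish. *)
Definition is_R1 (R1 : 'M[K]_(m, n) -> 'M[K]_(m, n)) : Prop :=
  exists N0, forall N, (N0 <= N)%N -> forall X, R1 X = \sum_(k < N) R1_term k X.

Definition is_Rmatrix (R : 'M[K]_(m, n) -> 'M[K]_(m, n)) : Prop :=
  exists R0 R1, [/\ is_R0 R0, is_R1 R1 & R = R0 \o R1].

End RMatrix.

(* Theta is the R_1 of the universal R-matrix R = R_0 R_1: its term of degree *)
(* 0 is 1 (x) 1, and R Delta = Delta^op R on U (x) V for U, V in O_f.         *)
Definition universal_R (Theta : R_series) : Prop :=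
  Theta 0 [tuple] [tuple] = 1 /\
  forall m n (a : Uq_action 'rV[K]_m) (b : Uq_action 'rV[K]_n),
    is_Uq_module a -> in_Of a setT -> is_Uq_module b -> in_Of b setT ->
    exists2 R, is_Rmatrix Theta a b R &
               equivariant (tens_action a b) (tens_action_op a b) R.

Definition braiding m n (R : 'M[K]_(m, n) -> 'M[K]_(m, n)) (X : 'M[K]_(m, n)) :
  'M[K]_(n, m) := (R X)^T.

Definition std_action : Uq_action 'rV[K]_d := UqAction
  (fun i v => v *m \matrix_(r, s) ((r == i.+1 :> nat) && (s == i :> nat))%:R)
  (fun i v => v *m \matrix_(r, s) ((r == i :> nat) && (s == i.+1 :> nat))%:R)
  (fun l v => \row_j (q ^ l 0 j * v 0 j)).

End QuantumGL.

Section BraidedSymmetric.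
Variables (K : fieldType) (q : K) (n : nat).
(* The tensor algebra of V = K^n. *)
Local Notation T := (freealg K 'I_n).

Definition emb1 (v : 'rV[K]_n) : T := \sum_i v 0 i *: gen K i.
Definition emb2 (X : 'M[K]_n) : T := \sum_i \sum_j X i j *: (gen K i * gen K j).

Definition tpow (k : nat) : set T := lspan [set word K w | w in [set w | size w = k]].

(* The action of U_q(gl_d) on T(V) through the iterated coproduct (and the    *)
(* counit in degree 0).                                                       *)
Section TensorAction.
Variables (d : nat) (a : Uq_action d 'rV[K]_n).
Let e (j : 'I_n) : 'rV[K]_n := delta_mx 0 j.

Definition wordK (l : weight d) (w : seq 'I_n) : T :=
  \prod_(j <- w) emb1 (actK a l (e j)).

Fixpoint wordE (i : 'I_d.-1) (w : seq 'I_n) : T :=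
  if w is j :: w' then
    emb1 (actE a i (e j)) * word K w' + emb1 (actK a (alpha i) (e j)) * wordE i w'
  else 0.

Fixpoint wordF (i : 'I_d.-1) (w : seq 'I_n) : T :=
  if w is j :: w' then
    emb1 (actF a i (e j)) * wordK (- alpha i) w' + gen K j * wordF i w'
  else 0.

Definition lin_ext (f : seq 'I_n -> T) (x : T) : T :=
  \sum_(w <- msupp x) x@_w *: f (fmonom_val w).

Definition tensor_algebra_action : Uq_action d T :=
  UqAction (fun i => lin_ext (wordE i)) (fun i => lin_ext (wordF i))
           (fun l => lin_ext (wordK l)).

End TensorAction.

Section Braided.
Variable c : 'M[K]_n -> 'M[K]_n.

Definition S2 : set 'M[K]_n := lspan [set X | exists k : int, c X = q ^ k *: X].
Definition L2 : set 'M[K]_n := lspan [set X | exists k : int, c X = - q ^ k *: X].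

(* The intersection is empty when k < 2, leaving V^(x)0 = K and V^(x)1 = V. *)
Definition braided_sym_power (k : nat) : set T :=
  [set x | tpow k x /\ forall i j, (i + 2 + j)%N = k ->
     lspan [set y | exists u s v, [/\ tpow i u, S2 s, tpow j v &
                                      y = u * emb2 s * v]] x].

Definition flat : Prop :=
  forall k, has_dim (braided_sym_power k) 'C(n + k - 1, k).

Definition braided_sym_alg := quotalg (emb2 @` L2).

Definition braided_sym_alg_comp (k : nat) : set braided_sym_alg :=
  @quot_proj K 'I_n (emb2 @` L2) @` tpow k.

End Braided.

Definition qpoly_alg := quotalg
  [set y : T | exists i j : 'I_n,
     (i < j)%N /\ y = gen K j * gen K i - q *: (gen K i * gen K j)].

End BraidedSymmetric.

Arguments braided_sym_alg_comp {K} q {n} c k.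

(* Main.v *)
Require Import Defs.
From HB Require Import structures.
From mathcomp Require Import all_boot all_order all_algebra.
From mathcomp Require Import generic_quotient.
From mathcomp Require Import complex finmap monalg ring.
From mathcomp Require Import boolp classical_sets functions reals.

Set Implicit Arguments.
Unset Strict Implicit.
Unset Printing Implicit Defensive.

Import GRing.Theory.
Local Open Scope ring_scope.
Local Open Scope classical_set_scope.

(* On V (x) V the braiding commutes with U_q(gl_d), and R_1 has the form
   1 + sum F_I (x) E_J with F_I moving basis indices up and E_J down.  Weights and
   equivariance under the F_i then force, for i < j,
     c(e_i e_j) = e_j e_i + (q - q^-1) e_i e_j,  c(e_j e_i) = e_i e_j,
     c(e_i e_i) = q e_i e_i,
   so S^2 is spanned by the e_i e_i and the e_i e_j + q^-1 e_j e_i, and Lambda^2 by the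
   e_j e_i - q^-1 e_i e_j.

   The braided symmetric algebra is compared with the space of all functions on Z^d,
   the function supported at a playing the role of the monomial x^a.  There the x_i
   act by x_j x_i = q^-1 x_i x_j, and U_q(gl_d) acts by q-difference operators
   which send x^a to a multiple of x^(a +- alpha_i).  Words and their
   sorted rearrangements agree up to a power of q modulo the relations, whence the
   comparison map is injective, the action descends to the quotient, and sorted words
   give a basis in each degree.  The same power of q describes the tensors in
   S^n, which gives flatness.  Each degree is irreducible because raising operators
   lead from any nonzero vector to x_1^n and lowering operators from there to all
   monomials.  The relations x_j x_i = q x_i x_j arise by reversing the order of the
   variables. *)

(** The quotient algebra is known only by its relations, so a representation is needed to show that
    it does not collapse. Admitting all functions on Z^d, and not just polynomials, makes E_i and
    F_i plain shifts times a coefficient: every defining relation then becomes an identity of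
    rational functions in q and the numbers q^(a_j), without boundary cases. The polynomials are
    respected all the same, since the coefficient of E_i vanishes where a_(i+1) = 0 and that of F_i
    where a_i = 0.

    The power of q attached to a word is q^(-inv), with inv its number of inversions. It governs
    both the quotient and the tensors in S^n because x_j x_i = q^-1 x_i x_j and the symmetry X_ji =
    q^-1 X_ij of matrices in S^2 involve the same factor.

    Universality of R only yields some equivariant operator on V (x) V; the given one coincides with
    it because R_0 and R_1 are determined on V (x) V. The signs of the eigenvalues q and -q^-1 are
    meaningful because no power of q equals -1, which is where 2 != 0 enters. *)

Section RootOfUnity.
Variables (K : fieldType) (q : K).
Hypotheses (q_neq0 : q != 0) (q_inf : forall m, (0 < m)%N -> q ^+ m != 1).

Lemma exprz_eq1 (z : int) : q ^ z = 1 -> z = 0.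
Proof.
case: z => [[|m]|m] //; first by move=> /eqP; rewrite (negPf (q_inf _)).
by move=> /eqP; rewrite NegzE -invr_expz invr_eq1 (negPf (q_inf _)).
Qed.

Lemma exprz_inj (y z : int) : q ^ y = q ^ z -> y = z.
Proof.
move=> yz; apply/eqP; rewrite -subr_eq0; apply/eqP; apply: exprz_eq1.
by rewrite expfzDr// yz -invr_expz divff// expfz_neq0.
Qed.

End RootOfUnity.

(** * Linear algebra in free and quotient algebras *)

Section LinearClosure.
Variables (K : fieldType) (M : lmodType K).

Definition lin_closed (N : set M) : Prop :=
  N 0 /\ forall k u v, N u -> N v -> N (k *: u + v).

Lemma lin_closed_sum (N : set M) (J : Type) (s : seq J) (P : pred J) (F : J -> M) :
  lin_closed N -> (forall i, P i -> N (F i)) -> N (\sum_(i <- s | P i) F i).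
Proof.
move=> [N0 NS] NF; apply: big_ind => // x y Nx Ny.
by rewrite -[x]scale1r; exact: NS.
Qed.

Lemma lin_closedZ (N : set M) k x : lin_closed N -> N x -> N (k *: x).
Proof. by move=> [N0 NS] Nx; rewrite -[_ *: x]addr0; exact: NS. Qed.

Lemma lin_closedD (N : set M) x y : lin_closed N -> N x -> N y -> N (x + y).
Proof. by move=> [N0 NS] Nx Ny; rewrite -[x]scale1r; exact: NS. Qed.

Lemma lspan_closed (A : set M) : lin_closed (lspan A).
Proof. by split=> [|k u v ? ?]; [exact: lspan0|apply: lspanD => //; apply: lspanZ]. Qed.

(** The induction principle for spans. The motive [N] is usually a kernel or a preimage under a
    linear map, closed by [linear_ker_closed] or [lin_closed_preim]. *)
Lemma lspan_sub (A N : set M) : lin_closed N -> A `<=` N -> lspan A `<=` N.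
Proof.
move=> Nlin AN _ [s sA ->]; rewrite big_seq; apply: lin_closed_sum => // t ts.
by apply: lin_closedZ => //; apply: AN; exact: sA.
Qed.

Lemma lspan_incl (A : set M) : A `<=` lspan A.
Proof.
move=> x Ax; exists [:: (1, x)]; last by rewrite big_seq1 scale1r.
by move=> t; rewrite inE => /eqP ->.
Qed.

End LinearClosure.

Section LinearFunctions.
Variables (K : fieldType) (M M' : lmodType K) (f : M -> M').
Hypothesis f_lin : linear f.

Let f_add x y : f (x + y) = f x + f y.
Proof. by rewrite -{1}[x]scale1r f_lin scale1r. Qed.

Lemma linear_fun0 : f 0 = 0.
Proof. by apply: (@addrI _ (f 0)); rewrite -f_add !addr0. Qed.

Lemma linear_funD x y : f (x + y) = f x + f y.
Proof. exact: f_add. Qed.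

Lemma linear_funZ k x : f (k *: x) = k *: f x.
Proof. by rewrite -[k *: x]addr0 f_lin linear_fun0 addr0. Qed.

Lemma linear_funN x : f (- x) = - f x.
Proof. by rewrite -scaleN1r linear_funZ scaleN1r. Qed.

Lemma linear_funB x y : f (x - y) = f x - f y.
Proof. by rewrite f_add linear_funN. Qed.

Lemma linear_fun_sum (J : Type) (s : seq J) (P : pred J) (F : J -> M) :
  f (\sum_(i <- s | P i) F i) = \sum_(i <- s | P i) f (F i).
Proof. by apply: (big_morph f linear_funD linear_fun0). Qed.

Lemma linear_ker_closed : lin_closed [set x | f x = 0].
Proof. by split=> [|k u v /= fu fv]; rewrite /= ?linear_fun0// f_lin fu fv scaler0 addr0. Qed.

Lemma lin_closed_preim (N : set M') : lin_closed N -> lin_closed [set x | N (f x)].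
Proof.
move=> [N0 NS]; split=> [|k u v /= Nu Nv]; first by rewrite /= linear_fun0.
by rewrite /= f_lin; exact: NS.
Qed.

End LinearFunctions.

Section FreeAlgebra.
Variables (K : fieldType) (I : choiceType).
Local Notation T := (freealg K I).
Implicit Types (x y : T) (w : seq I).

Lemma word_nil : word K [::] = 1 :> T.
Proof. by rewrite /word -fmoneE. Qed.

Lemma word_cat w w' : word K (w ++ w') = word K w * word K w' :> T.
Proof.
rewrite /word malgM_def fgmulUU mulr1; congr (mkmalgU _ _).
by rewrite -[RHS]/(fmmul _ _) fmmulE.
Qed.

Lemma word_cons i w : word K (i :: w) = gen K i * word K w :> T.
Proof. by rewrite -cat1s word_cat. Qed.

Lemma freealg_sum_words x :
  x = \sum_(m <- msupp x) x@_m *: word K (fmonom_val m).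
Proof.
rewrite {1}[x]monalgE; apply: eq_bigr => m _; apply/malgP => k.
by rewrite mcoeffZ !mcoeffU fmK mulrnAr mulr1.
Qed.

Lemma mcoeff_word w m : (word K w : T)@_m = (w == fmonom_val m)%:R.
Proof. by rewrite mcoeffU; case: m. Qed.

Lemma linear_word_ext (M : lmodType K) (f g : T -> M) : linear f -> linear g ->
  (forall w, f (word K w) = g (word K w)) -> f =1 g.
Proof.
move=> fl gl fg x; rewrite [x]freealg_sum_words.
rewrite (linear_fun_sum fl) (linear_fun_sum gl); apply: eq_bigr => m _.
by rewrite (linear_funZ fl) (linear_funZ gl) fg.
Qed.

Lemma lin_closed_words (N : set T) : lin_closed N ->
  (forall w, N (word K w)) -> forall x, N x.
Proof.
move=> Nl Nw x; rewrite [x]freealg_sum_words; apply: lin_closed_sum => // m _.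
exact: lin_closedZ.
Qed.

(** With values in the free algebra this is convertible to [lin_ext], so the results below apply
    directly to [tensor_algebra_action]. *)
Definition word_lin (M : lmodType K) (f : seq I -> M) x : M :=
  \sum_(m <- msupp x) x@_m *: f (fmonom_val m).

Section WordLin.
Variables (M : lmodType K) (f : seq I -> M).

(** Sums over the supports of x, y and k x + y can thus be brought to one index set, which gives
    linearity. *)
Lemma word_lin_supp (D : {fset {fmonom I}}) x : (msupp x `<=` D)%fset ->
  word_lin f x = \sum_(m <- D) x@_m *: f (fmonom_val m).
Proof.
move=> sub; rewrite /word_lin (big_fset_incl _ sub)// => m _ mx.
by rewrite (mcoeff_outdom mx) scale0r.
Qed.

Lemma word_lin_linear : linear (word_lin f).
Proof.
move=> k x y; pose D := (msupp x `|` msupp y)%fset.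
rewrite !(@word_lin_supp D) ?fsubsetUl ?fsubsetUr//; last first.
  apply: fsubset_trans (msuppD_le _ _) _; apply: fsetSU; exact: msuppZ_le.
rewrite scaler_sumr -big_split; apply: eq_bigr => m _ /=.
by rewrite mcoeffD mcoeffZ scalerDl scalerA.
Qed.

Lemma word_lin_word w : word_lin f (word K w) = f w.
Proof. by rewrite /word_lin msuppU1 big_seq_fset1 mcoeffUU scale1r. Qed.

End WordLin.

(** Pulls the scalars out of the recursive clause of [wordE]. The next three lemmas do this for
    [wordF] and for words of length one. *)
Lemma mul_scale_add k k' x x' y y' z z' : z = k *: x -> z' = k' *: x' ->
  z * y + z' * y' = k *: (x * y) + k' *: (x' * y').
Proof. by move=> -> ->; rewrite !scalerAl. Qed.

Lemma mul_scale_add1 k x y z u : z = k *: x -> z * y + u = k *: (x * y) + u.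
Proof. by move=> ->; rewrite scalerAl. Qed.

Lemma mul_scale_add_unit k k' x x' y y' : y = 1 -> y' = 0 ->
  k *: (x * y) + k' *: (x' * y') = k *: x.
Proof. by move=> -> ->; rewrite mulr1 mulr0 scaler0 addr0. Qed.

Lemma mul_scale_add_unit1 k x x' y y' : y = 1 -> y' = 0 ->
  k *: (x * y) + x' * y' = k *: x.
Proof. by move=> -> ->; rewrite mulr1 mulr0 addr0. Qed.

Lemma mull_linear x : linear ( *%R x).
Proof. by move=> k y z; rewrite mulrDr scale_mulr. Qed.

Lemma mulr_linear x : linear ( *%R^~ x).
Proof. by move=> k y z; rewrite mulrDl scalerAl. Qed.

Lemma comp_linear (M M' M'' : lmodType K) (f : M' -> M'') (g : M -> M') :
  linear f -> linear g -> linear (f \o g).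
Proof. by move=> fl gl k x y /=; rewrite gl fl. Qed.

Lemma bilinear_word_ext (M : lmodType K) (f g : T -> T -> M) :
  (forall x, linear (f x)) -> (forall y, linear (f^~ y)) ->
  (forall x, linear (g x)) -> (forall y, linear (g^~ y)) ->
  (forall w w', f (word K w) (word K w') = g (word K w) (word K w')) -> f =2 g.
Proof.
move=> f1 f2 g1 g2 fg x y; apply: (linear_word_ext (f1 x) (g1 x)) => w'.
by apply: (linear_word_ext (f2 (word K w')) (g2 (word K w'))) => w.
Qed.

End FreeAlgebra.

Section QuotientAlgebraTheory.
Variables (K : fieldType) (I : choiceType) (G : set (freealg K I)).
Local Notation T := (freealg K I).
Local Notation pi := (@quot_proj K I G).

Lemma quot_proj_linear : linear pi.
Proof. by move=> k x y; rewrite quot_projD quot_projZ. Qed.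

Lemma ideal_gen x : G x -> x \in ideal G.
Proof.
by move=> Gx; apply/idealP/lspan_incl; exists 1, x, 1; rewrite mul1r mulr1.
Qed.

Lemma ideal_closed : lin_closed [set x | x \in ideal G].
Proof. by split=> [|k u v /= uG vG]; [exact: rpred0|rewrite /= rpredD// idealZ]. Qed.

Lemma ideal_sub (N : set T) : lin_closed N ->
  (forall a g b, G g -> N (a * g * b)) -> forall x, x \in ideal G -> N x.
Proof.
move=> Nl NG x /idealP; apply: lspan_sub => // _ [a [g [b [Gg ->]]]].
exact: NG.
Qed.

(** The scalar stays existential: reordering only needs a nonzero factor, whose value is recovered
    in [word_perm_ideal] by evaluation in the model. *)
Definition scalar_cong (x y : T) : Prop := exists2 c, c != 0 & x - c *: y \in ideal G.

Lemma scalar_cong_refl x : scalar_cong x x.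
Proof. by exists 1; rewrite ?oner_neq0// scale1r subrr rpred0. Qed.

Lemma scalar_cong_trans x y z : scalar_cong x y -> scalar_cong y z -> scalar_cong x z.
Proof.
move=> [c c0 xy] [e e0 yz]; exists (c * e); first by rewrite mulf_neq0.
have -> : x - (c * e) *: z = (x - c *: y) + c *: (y - e *: z).
  by rewrite scalerBr scalerA addrA subrK.
exact: (lin_closedD ideal_closed xy (idealZ c yz)).
Qed.

Lemma scalar_cong_mull a x y : scalar_cong x y -> scalar_cong (a * x) (a * y).
Proof.
move=> [c c0 xy]; exists c; first exact: c0.
have -> : a * x - c *: (a * y) = a * (x - c *: y).
  by rewrite -scale_mulr -mulrBr.
exact: idealMl.
Qed.

Lemma scalar_cong_mulr a x y : scalar_cong x y -> scalar_cong (x * a) (y * a).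
Proof.
move=> [c c0 xy]; exists c; first exact: c0.
have -> : x * a - c *: (y * a) = (x - c *: y) * a.
  by rewrite scalerAl -mulrBl.
exact: (Defs.idealMr a xy).
Qed.

(** The first letter of [w] occurs in [w'] and is carried to the front there by adjacent swaps; the
    remaining letters are handled by induction. *)
Lemma scalar_cong_word_perm w w' :
  (forall i j, scalar_cong (gen K i * gen K j) (gen K j * gen K i)) ->
  perm_eq w w' -> scalar_cong (word K w) (word K w').
Proof.
move=> swap; elim: w w' => [|j w IH] w' ww'.
  by rewrite perm_sym in ww'; move/perm_nilP: ww' => ->; exact: scalar_cong_refl.
have /splitPr jw' : j \in w' by rewrite -(perm_mem ww') mem_head.
case: jw' ww' => u v; rewrite perm_sym -cat1s perm_catCA perm_cons perm_sym => wuv.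
apply: (@scalar_cong_trans _ (word K (j :: u ++ v))).
  by rewrite 2!word_cons; apply: scalar_cong_mull; exact: IH.
elim: u {wuv} => [|k u IHu] /=; first exact: scalar_cong_refl.
apply: (@scalar_cong_trans _ (word K (k :: j :: u ++ v))).
  rewrite 4!word_cons 2!mulrA; apply: scalar_cong_mulr; exact: swap.
by rewrite (word_cons _ k) (word_cons _ k); apply: scalar_cong_mull.
Qed.

End QuotientAlgebraTheory.

Section TensorPowers.
Variables (K : fieldType) (n : nat).
Local Notation T := (freealg K 'I_n).

Lemma tpow_closed k : lin_closed (@tpow K n k).
Proof. exact: lspan_closed. Qed.

Lemma tpow_word w : tpow (size w) (word K w : T).
Proof. by apply: lspan_incl; exists w. Qed.

Lemma tpow_ind k (N : set T) : lin_closed N ->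
  (forall w, size w = k -> N (word K w)) -> tpow k `<=` N.
Proof. by move=> Nl Nw; apply: lspan_sub => // _ [w wk <-]; exact: Nw. Qed.

Lemma tpowM k l (x y : T) : tpow k x -> tpow l y -> tpow (k + l) (x * y).
Proof.
move=> xk yl; move: x xk; apply: tpow_ind => [|w wk].
  exact (lin_closed_preim (mulr_linear y) (tpow_closed (k + l))).
move: y yl; apply: tpow_ind => [|w' wl].
  exact (lin_closed_preim (mull_linear (word K w)) (tpow_closed (k + l))).
by rewrite -wk -wl -size_cat -word_cat; exact: tpow_word.
Qed.

Lemma tpowP k (x : T) : tpow k x <-> forall m, x@_m != 0 -> size (fmonom_val m) = k.
Proof.
split=> [|xk].
  move: x; apply: tpow_ind => [|w wk m]; last first.
    by rewrite mcoeff_word; case: (w =P fmonom_val m) => [<-//|_]; rewrite eqxx.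
  split=> [m|c u v uk vk m]; first by rewrite mcoeff0 eqxx.
  rewrite mcoeffD mcoeffZ; have [->|/uk//] := eqVneq u@_m 0.
  by rewrite mulr0 add0r; exact: vk.
rewrite [x]freealg_sum_words big_seq; apply: lin_closed_sum => [|m].
  exact: tpow_closed.
rewrite -mcoeff_neq0 => /xk <-.
by apply: lin_closedZ; [exact: tpow_closed|exact: tpow_word].
Qed.

End TensorPowers.

Section LowDegree.
Variables (K : fieldType) (n : nat).

Lemma emb1_linear : linear (@emb1 K n).
Proof.
move=> k u v; rewrite /emb1 scaler_sumr -big_split; apply: eq_bigr => j _ /=.
by rewrite !mxE scalerDl scalerA.
Qed.

Lemma emb1_delta (j : 'I_n) : emb1 (delta_mx 0 j) = gen K j.
Proof.
rewrite /emb1 (bigD1 j)//= mxE !eqxx scale1r big1 ?addr0// => k kj.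
by rewrite mxE eqxx (negPf kj) scale0r.
Qed.

Lemma emb2_linear : linear (@emb2 K n).
Proof.
move=> k X Y; rewrite /emb2 scaler_sumr -big_split; apply: eq_bigr => i _ /=.
rewrite scaler_sumr -big_split; apply: eq_bigr => j _ /=.
by rewrite !mxE scalerDl scalerA.
Qed.

Lemma emb2_delta (i j : 'I_n) : emb2 (delta_mx i j) = gen K i * gen K j.
Proof.
rewrite /emb2 (bigD1 i)//= [X in _ + X]big1 ?addr0 => [|k ki]; last first.
  by rewrite big1// => l _; rewrite mxE (negPf ki) scale0r.
rewrite (bigD1 j)//= mxE !eqxx scale1r big1 ?addr0// => k kj.
by rewrite mxE (negPf kj) andbF scale0r.
Qed.

Lemma tpow_emb2 (X : 'M[K]_n) : tpow 2 (emb2 X).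
Proof.
apply: lin_closed_sum => [|i _]; first exact: tpow_closed.
apply: lin_closed_sum => [|j _]; first exact: tpow_closed.
apply: lin_closedZ; first exact: tpow_closed.
exact: (tpowM (tpow_word K [:: i]) (tpow_word K [:: j])).
Qed.

End LowDegree.

(** * Functions on the weight lattice as a U_q(gl_d)-module *)

(** The value at [a] is the coefficient of x^a. Negative exponents and infinite supports are
    allowed, so that shifts are defined everywhere. *)
Definition model_space (K : fieldType) (n : nat) : Type := weight n.+1 -> K.

HB.instance Definition _ (K : fieldType) (n : nat) :=
  GRing.Lmodule.copy (model_space K n) (weight n.+1 -> K^o).

Section ModelSpace.
Variables (K : fieldType) (n : nat).
Implicit Types (f g : model_space K n).

Lemma msD f g b : (f + g) b = f b + g b. Proof. by []. Qed.
Lemma msN f b : (- f) b = - f b. Proof. by []. Qed.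
Lemma msZ k f b : (k *: f) b = k * f b. Proof. by []. Qed.
Lemma ms0 b : (0 : model_space K n) b = 0. Proof. by []. Qed.
Definition msE := (msD, msN, msZ, ms0).

End ModelSpace.

Section QuantumPolynomialModel.
Variables (K : fieldType) (q : K) (n : nat).
Hypotheses (q_neq0 : q != 0) (q_sq_neq1 : q ^+ 2 != 1).
Local Notation d := n.+1.
Local Notation weight := (weight d).

Definition lo (i : 'I_d.-1) : 'I_d := widen_ord (leqnSn n) i.
Definition hi (i : 'I_d.-1) : 'I_d := lift ord0 i.
Definition unit_wt (j : 'I_d) : weight := delta_mx 0 j.

Lemma hi_lo_neq i : (hi i == lo i) = false.
Proof. by rewrite -val_eqE /= /bump /= add1n gtn_eqF. Qed.

Lemma alphaE i : alpha i = unit_wt (lo i) - unit_wt (hi i).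
Proof. by apply/rowP => j; rewrite !mxE eqxx /= -!val_eqE /= /bump /= add1n !natz. Qed.

Lemma pairingC (l m : weight) : pairing l m = pairing m l.
Proof. by apply: eq_bigr => j _; rewrite mulrC. Qed.

Lemma pairingDr (l m m' : weight) : pairing l (m + m') = pairing l m + pairing l m'.
Proof. by rewrite -big_split; apply: eq_bigr => j _; rewrite mxE mulrDr. Qed.

Lemma pairingDl (l l' m : weight) : pairing (l + l') m = pairing l m + pairing l' m.
Proof. by rewrite !(pairingC _ m) pairingDr. Qed.

Lemma pairing0r (l : weight) : pairing l 0 = 0.
Proof. by rewrite /pairing big1 // => j _; rewrite mxE mulr0. Qed.

Lemma pairingNr (l m : weight) : pairing l (- m) = - pairing l m.
Proof. by rewrite /pairing -sumrN; apply: eq_bigr => j _; rewrite mxE mulrN. Qed.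

Lemma pairingNl (l m : weight) : pairing (- l) m = - pairing l m.
Proof. by rewrite !(pairingC _ m) pairingNr. Qed.

Lemma pairing_unit (l : weight) j : pairing l (unit_wt j) = l 0 j.
Proof.
rewrite /pairing (bigD1 j)//= mxE !eqxx mulr1 big1 ?addr0// => k kj.
by rewrite mxE eqxx (negPf kj) mulr0.
Qed.

Lemma pairing_alpha (l : weight) i : pairing l (alpha i) = l 0 (lo i) - l 0 (hi i).
Proof. by rewrite alphaE pairingDr pairingNr !pairing_unit. Qed.

(* [qX j a] is the eigenvalue of K_(e_j) on the monomial x^a; [qS j a] is the scalar picked
   up by x_j when it is moved to its place past the variables of smaller index. *)
Definition qX (j : 'I_d) (a : weight) : K := q ^ a 0 j.
Definition qS (j : 'I_d) (a : weight) : K := q ^ (- \sum_(k < d | (k < j)%N) a 0 k).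

Lemma qX_neq0 j a : qX j a != 0. Proof. exact: expfz_neq0. Qed.
Lemma qS_neq0 j a : qS j a != 0. Proof. exact: expfz_neq0. Qed.

Lemma qXD j a b : qX j (a + b) = qX j a * qX j b.
Proof. by rewrite /qX mxE expfzDr. Qed.

Lemma qXB j a b : qX j (a - b) = qX j a / qX j b.
Proof. by apply: (mulIf (qX_neq0 j b)); rewrite -qXD subrK divfK// qX_neq0. Qed.

Lemma qSD j a b : qS j (a + b) = qS j a * qS j b.
Proof.
rewrite /qS -expfzDr// -opprD -big_split; congr (q ^ (- _)).
by apply: eq_bigr => k _; rewrite mxE.
Qed.

Lemma qSB j a b : qS j (a - b) = qS j a / qS j b.
Proof.
by apply: (mulIf (qS_neq0 j b)); rewrite -qSD subrK divfK// qS_neq0.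
Qed.

Lemma qX_unit j k : qX j (unit_wt k) = if j == k then q else 1.
Proof. by rewrite /qX mxE eqxx; case: eqP => _ /=; rewrite ?expr1z ?expr0z. Qed.

Lemma qS_unit j k : qS j (unit_wt k) = if (k < j)%N then q^-1 else 1.
Proof.
rewrite /qS; case: ifP => kj.
  rewrite (bigD1 k)//= mxE !eqxx big1 ?addr0 ?exprN1//.
  by move=> m /andP[_ mk]; rewrite mxE eqxx (negPf mk).
by rewrite big1 ?oppr0 ?expr0z// => m mj; rewrite mxE eqxx; case: eqP kj mj => // -> ->.
Qed.

Lemma qX_alpha j i :
  qX j (alpha i) = if j == lo i then q else if j == hi i then q^-1 else 1.
Proof.
rewrite alphaE qXB !qX_unit; case: (eqVneq j (lo i)) => [->|_].
  by rewrite eq_sym hi_lo_neq divr1.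
by case: ifP; rewrite ?div1r ?invr1.
Qed.

(** The coordinates of [alpha i] at indices below [j] sum to 1 if [j] is [hi i] and to 0
    otherwise. *)
Lemma qS_alpha j i : qS j (alpha i) = if j == hi i then q^-1 else 1.
Proof.
rewrite alphaE qSB !qS_unit /= /bump /= add1n.
have [->|jhi] := eqVneq j (hi i).
  by rewrite /= /bump /= add1n ltnSn ltnn divr1.
have -> : (i < j)%N = (i.+1 < j)%N.
  rewrite leq_eqVlt; case: eqP => // e; case/eqP: jhi; apply: val_inj.
  by rewrite /= /bump /= add1n e.
by case: ifP => _; rewrite ?divr1// divff// invr_eq0.
Qed.

Lemma qS_hi i a : qS (hi i) a = qS (lo i) a / qX (lo i) a.
Proof.
rewrite /qS /qX invr_expz -expfzDr// -opprD; congr (q ^ (- _)).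
rewrite (bigD1 (lo i)) /= ?/bump /= ?add1n ?ltnSn// addrC; congr (_ + _).
apply: eq_bigl => k; rewrite ltnS -val_eqE /= andbC.
by rewrite [RHS]ltn_neqAle.
Qed.

Local Notation P := (model_space K n).

Definition mult_op (j : 'I_d) (f : P) : P := fun a => qS j a * f (a - unit_wt j).

(* q^(a_i - a_(i+1) + 1) [a_(i+1)] and q^(a_(i+1) - a_i + 1) [a_i], with quantum integers. *)
Definition raise_coef i (a : weight) : K :=
  qX (lo i) a * (1 - qX (hi i) a ^- 2) / (1 - q ^- 2).
Definition lower_coef i (a : weight) : K :=
  qX (hi i) a * (1 - qX (lo i) a ^- 2) / (1 - q ^- 2).

Definition modelE i (f : P) : P := fun b => raise_coef i (b - alpha i) * f (b - alpha i).
Definition modelF i (f : P) : P := fun b => lower_coef i (b + alpha i) * f (b + alpha i).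
Definition modelK (l : weight) (f : P) : P := fun b => q ^ pairing l b * f b.

Definition model_action : Uq_action d P := UqAction modelE modelF modelK.

Lemma pairing_alphas (i j : 'I_d.-1) : pairing (alpha i) (alpha j) =
  (i == j)%:R *+ 2 - (i == j.+1 :> nat)%:R - (j == i.+1 :> nat)%:R.
Proof.
rewrite pairing_alpha !mxE /= /bump /= !add1n -!val_eqE /= eqSS (eq_sym (j : nat) i).
by rewrite (eq_sym j.+1) mulr2n !natz; ring.
Qed.

Lemma pairing_alphas_eq0 (i j : 'I_d.-1) : pairing (alpha i) (alpha j) = 0 ->
  [/\ i != j, (i == j.+1 :> nat) = false & (j == i.+1 :> nat) = false].
Proof.
rewrite pairing_alphas; case: (eqVneq i j) => [<-|_].
  by rewrite (ltn_eqF (ltnSn i)).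
have [->|_] := eqVneq (i : nat) j.+1; first by rewrite ltn_eqF// leqW.
by have [_|_] := eqVneq (j : nat) i.+1.
Qed.

Lemma pairing_alphas_eqN1 (i j : 'I_d.-1) : pairing (alpha i) (alpha j) = -1 ->
  (i == j.+1 :> nat) || (j == i.+1 :> nat).
Proof.
rewrite pairing_alphas; case: (eqVneq i j) => [<-|_].
  by rewrite (ltn_eqF (ltnSn i)).
by case: eqP => //=; case: eqP.
Qed.


Lemma modelE_linear i : linear (modelE i).
Proof.
by move=> k f g; apply/funext => b; rewrite /modelE !msE mulrDr mulrCA.
Qed.

Lemma modelF_linear i : linear (modelF i).
Proof.
by move=> k f g; apply/funext => b; rewrite /modelF !msE mulrDr mulrCA.
Qed.

Lemma modelK_linear l : linear (modelK l).
Proof.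
by move=> k f g; apply/funext => b; rewrite /modelK !msE mulrDr mulrCA.
Qed.

Lemma lo_hi_neq i : (lo i == hi i) = false.
Proof. by rewrite eq_sym hi_lo_neq. Qed.

(** Bundled as one rewrite rule to resolve the conditionals of [qX_alpha] for neighbouring roots;
    [distant_neq] does the same for orthogonal ones. *)
Lemma adjacent_neq i j : lo j = hi i ->
  ((hi j == lo i) = false) * ((hi j == hi i) = false) *
  ((lo i == hi j) = false) * ((hi i == hi j) = false).
Proof.
move=> /(congr1 val) /=; rewrite /bump /= add1n => ji.
rewrite ![_ == hi j]eq_sym -!val_eqE /= /bump /= !add1n ji.
by rewrite !gtn_eqF// ltnS leqW.
Qed.

Lemma distant_neq i j : i != j -> lo j != hi i -> lo i != hi j ->
  ((lo i == lo j) = false) * ((lo i == hi j) = false) *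
  ((hi i == lo j) = false) * ((hi i == hi j) = false) *
  ((lo j == lo i) = false) * ((lo j == hi i) = false) *
  ((hi j == lo i) = false) * ((hi j == hi i) = false).
Proof.
move=> /negPf ij /negPf ji1 /negPf ij1; rewrite ![hi _ == lo _]eq_sym ji1 ij1.
have lo_eq k l : (lo k == lo l) = (k == l) by rewrite -val_eqE.
have hi_eq k l : (hi k == hi l) = (k == l) by rewrite (inj_eq lift_inj).
by rewrite !lo_eq !hi_eq ij eq_sym ij.
Qed.

Lemma pairing_alphas_eq0P i j : pairing (alpha i) (alpha j) = 0 ->
  [/\ i != j, lo j != hi i & lo i != hi j].
Proof.
move=> /pairing_alphas_eq0[-> ? ?].
by split=> //; rewrite -val_eqE /= /bump /= add1n; exact/negbT.
Qed.

Lemma pairing_alphas_eqN1P i j : pairing (alpha i) (alpha j) = -1 ->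
  lo j = hi i \/ lo i = hi j.
Proof.
move=> /pairing_alphas_eqN1/orP[]/eqP e; [right|left]; apply: val_inj.
  by rewrite /= /bump /= add1n e.
by rewrite /= /bump /= add1n e.
Qed.

Let q_sqB1 : q ^+ 2 - 1 != 0. Proof. by rewrite subr_eq0. Qed.

(** Once the shifts are expanded, the numbers [qX j b] and the sampled value [z] can be treated as
    independent variables, the former nonzero: what remains is an identity of rational functions. *)
Ltac qX_field b z :=
  repeat match goal with |- context [qX ?j b] =>
    move: (qX j b) (qX_neq0 j b) => ? ? end;
  move: z => ?;
  field; repeat (apply/andP; split); first [assumption | exact: oner_neq0 | exact: q_sqB1].

(** For i = j the two products of coefficients differ by the quantum integer [b_i - b_(i+1)]. For i
    != j both orders give the same product, even when the two roots share a coordinate. *)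
Lemma model_EF i j f :
  modelE i (modelF j f) - modelF j (modelE i f) =
  ((i == j)%:R / (q - q^-1)) *: (modelK (alpha i) f - modelK (- alpha i) f).
Proof.
apply/funext => b; rewrite /modelE /modelF /modelK !msE.
have [<-|ij] := eqVneq i j.
  rewrite addrK subrK /raise_coef /lower_coef pairingNl pairingC pairing_alpha.
  rewrite !qXB !qXD !qX_alpha !eqxx hi_lo_neq -invr_expz expfzDr// -invr_expz.
  rewrite -!/(qX _ _) -[true%:R]/(1 : K).
  qX_field b (f b).
rewrite !mul0r (addrAC b) /raise_coef /lower_coef !qXB !qXD !qX_alpha !eqxx.
have [ji|nji] := eqVneq (lo j) (hi i).
  rewrite ?ji ?eqxx ?(adjacent_neq ji) ?hi_lo_neq ?lo_hi_neq.
  qX_field b (f (b + alpha j - alpha i)).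
have [ji|nij] := eqVneq (lo i) (hi j).
  rewrite ?ji ?eqxx ?(adjacent_neq ji) ?hi_lo_neq ?lo_hi_neq.
  qX_field b (f (b + alpha j - alpha i)).
rewrite ?(distant_neq ij nji nij) ?hi_lo_neq.
qX_field b (f (b + alpha j - alpha i)).
Qed.

Lemma model_SerreE0 i j f : pairing (alpha i) (alpha j) = 0 ->
  modelE i (modelE j f) = modelE j (modelE i f).
Proof.
move=> /pairing_alphas_eq0P[ij nji nij]; apply/funext => b.
rewrite /modelE (addrAC b) /raise_coef !qXB !qX_alpha ?eqxx ?(distant_neq ij nji nij).
rewrite ?hi_lo_neq; qX_field b (f (b - alpha j - alpha i)).
Qed.

Lemma model_SerreF0 i j f : pairing (alpha i) (alpha j) = 0 ->
  modelF i (modelF j f) = modelF j (modelF i f).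
Proof.
move=> /pairing_alphas_eq0P[ij nji nij]; apply/funext => b.
rewrite /modelF (addrAC b) /lower_coef !qXD !qX_alpha ?eqxx ?(distant_neq ij nji nij).
rewrite ?hi_lo_neq; qX_field b (f (b + alpha j + alpha i)).
Qed.

Lemma model_SerreE1 i j f : pairing (alpha i) (alpha j) = -1 ->
  modelE i (modelE i (modelE j f))
  - (q + q^-1) *: modelE i (modelE j (modelE i f))
  + modelE j (modelE i (modelE i f)) = 0.
Proof.
move=> /pairing_alphas_eqN1P ij; apply/funext => b.
rewrite /modelE !msE.
rewrite !(addrAC _ (- alpha j) (- alpha i)) /raise_coef !qXB !qX_alpha !eqxx.
case: ij => ij; rewrite ?ij ?eqxx ?(adjacent_neq ij) ?hi_lo_neq ?lo_hi_neq.
  qX_field b (f (b - alpha i - alpha i - alpha j)).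
qX_field b (f (b - alpha i - alpha i - alpha j)).
Qed.

Lemma model_SerreF1 i j f : pairing (alpha i) (alpha j) = -1 ->
  modelF i (modelF i (modelF j f))
  - (q + q^-1) *: modelF i (modelF j (modelF i f))
  + modelF j (modelF i (modelF i f)) = 0.
Proof.
move=> /pairing_alphas_eqN1P ij; apply/funext => b.
rewrite /modelF !msE.
rewrite !(addrAC _ (alpha j) (alpha i)) /lower_coef !qXD !qX_alpha !eqxx.
case: ij => ij; rewrite ?ij ?eqxx ?(adjacent_neq ij) ?hi_lo_neq ?lo_hi_neq.
  qX_field b (f (b + alpha i + alpha i + alpha j)).
qX_field b (f (b + alpha i + alpha i + alpha j)).
Qed.

Lemma model_is_Uq_module : is_Uq_module q model_action.
Proof.
split=> /=.
- exact: modelE_linear.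
- exact: modelF_linear.
- exact: modelK_linear.
- by move=> f; apply/funext => b; rewrite /modelK pairingC pairing0r mul1r.
- by move=> l m f; apply/funext => b; rewrite /modelK pairingDl expfzDr// mulrA.
- move=> l i f; apply/funext => b; rewrite msZ /modelK /modelE.
  rewrite pairingDr pairingNr expfzDr// -invr_expz (pairingC _ l).
  move: (raise_coef _ _) (f _) (expfz_neq0 (pairing l (@alpha d i)) q_neq0) => c z h.
  by field.
- move=> l i f; apply/funext => b; rewrite msZ /modelK /modelF.
  rewrite pairingDr expfzDr// -invr_expz (pairingC _ l).
  move: (lower_coef _ _) (f _) (expfz_neq0 (pairing l (@alpha d i)) q_neq0) => c z h.
  by field.
- exact: model_EF.
- exact: model_SerreE0.
- exact: model_SerreE1.
- exact: model_SerreF0.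
- exact: model_SerreF1.
Qed.

Lemma mult_op_linear j : linear (mult_op j).
Proof.
by move=> k f g; apply/funext => b; rewrite /mult_op !msE mulrDr mulrCA.
Qed.

Lemma mult_op_comm (i j : 'I_d) f : (i < j)%N ->
  mult_op j (mult_op i f) = q^-1 *: mult_op i (mult_op j f).
Proof.
move=> ij; apply/funext => a; rewrite msZ /mult_op (addrAC a) !qSB !qS_unit.
rewrite ij ltnNge (ltnW ij) /= divr1 invrK.
move: (qS i a) (qS j a) (f _) => x y z.
by field.
Qed.

(** The twisted Leibniz rule dictated by Delta(E_i) = E_i (x) 1 + K_(alpha_i) (x) E_i, with x_j as
    left factor; it mirrors the recursion of [wordE]. *)
Lemma modelE_mult i j f : modelE i (mult_op j f) =
  (j == hi i)%:R *: mult_op (lo i) f + qX j (alpha i) *: mult_op j (modelE i f).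
Proof.
apply/funext => b; rewrite !msE /mult_op /modelE.
have [->|jhi] := eqVneq j (hi i).
  (* All terms now sample [f] at the same exponent, so only an identity between coefficients is
     left. *)
  have -> : b - unit_wt (lo i) = b - unit_wt (hi i) - alpha i.
    by rewrite alphaE opprB addrA subrK.
  rewrite (addrAC b (- alpha i)) /raise_coef !qXB !qX_alpha !qX_unit !eqxx hi_lo_neq lo_hi_neq.
  rewrite qSB qS_alpha eqxx !qS_hi -[true%:R]/(1 : K).
  move: (qS (lo i) b) (f _) => u v.
  (* The value of [f] is already the variable [v], so a dummy is passed. *)
  qX_field b (0 : K).
rewrite -[false%:R]/(0 : K) mul0r add0r qSB qS_alpha (negPf jhi) (addrAC b).
rewrite /raise_coef !qXB !qX_alpha !qX_unit !eqxx hi_lo_neq (eq_sym (hi i) j) (negPf jhi).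
rewrite (eq_sym (lo i)); case: (eqVneq j (lo i)) => [->|jlo].
  move: (qS (lo i) b) (f _) => u v.
  qX_field b (0 : K).
move: (qS j b) (f _) => u v.
qX_field b (0 : K).
Qed.

(** The twisted Leibniz rule for Delta(F_i) = F_i (x) K_(-alpha_i) + 1 (x) F_i. *)
Lemma modelF_mult i j f : modelF i (mult_op j f) =
  (j == lo i)%:R *: mult_op (hi i) (modelK (- alpha i) f) + mult_op j (modelF i f).
Proof.
apply/funext => b; rewrite !msE /mult_op /modelF /modelK.
have [->|jlo] := eqVneq j (lo i).
  have -> : b - unit_wt (hi i) = b + alpha i - unit_wt (lo i).
    by rewrite alphaE addrA addrAC addrK.
  rewrite (addrAC b (- _) (alpha i)) pairingNl pairingC pairing_alpha.
  rewrite -invr_expz expfzDr// -invr_expz -!/(qX _ _).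
  rewrite /lower_coef !qXB !qXD !qX_alpha !qX_unit !eqxx ?hi_lo_neq ?lo_hi_neq.
  rewrite !qSD !qS_alpha lo_hi_neq !qS_hi -[true%:R]/(1 : K).
  move: (qS (lo i) b) (f _) => u v.
  qX_field b (0 : K).
rewrite -[false%:R]/(0 : K) mul0r add0r qSD qS_alpha (addrAC b (- _) (alpha i)).
rewrite /lower_coef !qXB !qXD !qX_alpha !qX_unit !eqxx hi_lo_neq.
rewrite (eq_sym (hi i)) (eq_sym (lo i)) (negPf jlo).
case: (eqVneq j (hi i)) => [->|jhi].
  move: (qS (hi i) b) (f _) => u v.
  qX_field b (0 : K).
move: (qS j b) (f _) => u v.
qX_field b (0 : K).
Qed.

End QuantumPolynomialModel.

(** Each axiom is an equation between linear combinations of composed operators, hence can be tested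
    after an injective equivariant linear map. Both V and the quotient algebra inherit their module
    structure from the model in this way. *)
Lemma is_Uq_module_pullback (K : fieldType) (q : K) (d : nat) (M M' : lmodType K)
    (a : Uq_action d M) (a' : Uq_action d M') (f : M -> M') :
  linear f -> injective f -> equivariant a a' f ->
  is_Uq_module q a' -> is_Uq_module q a.
Proof.
move=> f_lin f_inj [fE fF fK] [lE lF lK K0 KD KE KF EF SE0 SE1 SF0 SF1].
have fD := linear_funD f_lin; have fZ := linear_funZ f_lin.
have fN := linear_funN f_lin; have f0 := linear_fun0 f_lin.
split.
- by move=> i k x y; apply: f_inj; rewrite fE !f_lin lE fE fE.
- by move=> i k x y; apply: f_inj; rewrite fF !f_lin lF fF fF.
- by move=> l k x y; apply: f_inj; rewrite fK !f_lin lK fK fK.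
- by move=> v; apply: f_inj; rewrite fK K0.
- by move=> l m v; apply: f_inj; rewrite !fK KD.
- by move=> l i v; apply: f_inj; rewrite fK fE KE fZ fE fK.
- by move=> l i v; apply: f_inj; rewrite fK fF KF fZ fF fK.
- by move=> i j v; apply: f_inj; rewrite fD fN fE !fF fE EF fZ fD fN !fK.
- by move=> i j v ij; apply: f_inj; rewrite !fE SE0.
- by move=> i j v ij; apply: f_inj; rewrite !(fD, fN, fZ, fE) f0; apply: SE1.
- by move=> i j v ij; apply: f_inj; rewrite !fF SF0.
- by move=> i j v ij; apply: f_inj; rewrite !(fD, fN, fZ, fF) f0; apply: SF1.
Qed.

(* Locked, since unification must not unfold sums in the monoid algebra. *)
HB.lock Definition rep (K : fieldType) (q : K) (n : nat) (x : freealg K 'I_n.+1)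
    (f : model_space K n) : model_space K n :=
  word_lin (fun w => foldr (@mult_op K q n) f w) x.

(** * The equivariant map from the tensor algebra to the model *)

Section TensorAlgebraModel.
Variables (K : fieldType) (q : K) (n : nat).
Hypotheses (q_neq0 : q != 0) (q_sq_neq1 : q ^+ 2 != 1).
Local Notation d := n.+1.
Local Notation weight := (weight d).
Local Notation T := (freealg K 'I_d).
Local Notation P := (model_space K n).
Local Notation mult := (@mult_op K q n).
Local Notation std := (std_action q d).
Local Notation tens := (tensor_algebra_action std).
Implicit Types (w : seq 'I_d) (x y : T) (f : P).

Definition dirac (a : weight) : P := fun b => (b == a)%:R.

Definition content w : weight := \sum_(j <- w) unit_wt j.

Lemma content_nil : content [::] = 0. Proof. exact: big_nil. Qed.

Lemma content_cons j w : content (j :: w) = unit_wt j + content w.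
Proof. exact: big_cons. Qed.

Lemma content_cat w w' : content (w ++ w') = content w + content w'.
Proof. exact: big_cat. Qed.

Lemma content_perm w w' : perm_eq w w' -> content w = content w'.
Proof. exact: perm_big. Qed.

Lemma content_count w j : content w 0 j = count_mem j w.
Proof.
elim: w => [|k w IH]; first by rewrite content_nil mxE.
by rewrite content_cons mxE IH mxE /= PoszD natz (eq_sym k).
Qed.

Lemma content_inj w w' : content w = content w' -> perm_eq w w'.
Proof.
move=> ww; apply/allP => j _ /=.
by have := congr1 (fun a : weight => a 0 j) ww; rewrite !content_count => -[->].
Qed.

(** This is q^(-inv), where inv counts the pairs of positions at which the earlier letter is
    strictly larger. *)
Fixpoint word_coef w : K :=
  if w is j :: w' then qS q j (content w) * word_coef w' else 1.

Lemma word_coef_neq0 w : word_coef w != 0.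
Proof. by elim: w => [|j w IH]; rewrite ?oner_neq0//= mulf_neq0// qS_neq0. Qed.

(** The left-hand word has one more inversion; the status of every other pair of letters is
    unchanged. *)
Lemma word_coef_swap u (i j : 'I_d) v : (i < j)%N ->
  word_coef (u ++ [:: j, i & v]) = q^-1 * word_coef (u ++ [:: i, j & v]).
Proof.
move=> ij; elim: u => [|k u IH] /=; last first.
  rewrite IH mulrCA; congr (_ * (_ * _)); congr qS; apply: content_perm.
  by rewrite perm_cons perm_cat2l (perm_catCA [:: j] [:: i] v).
rewrite !content_cons !qSD// !qS_unit// !ltnn ij ltnNge (ltnW ij) /=.
by rewrite !mul1r; ring.
Qed.

Local Notation rep := (@rep K q n).
(** The monomial 1 is [dirac 0], so this is the image of [x] under the action on 1. *)
Definition model_map x : P := rep x (dirac 0).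

Lemma rep_linear f : linear (rep^~ f).
Proof. by move=> k x y; rewrite rep.unlock word_lin_linear. Qed.

Lemma foldr_mult_linear w : linear (fun f => foldr mult f w).
Proof. by elim: w => // j w IH k f g /=; rewrite IH mult_op_linear. Qed.

Lemma rep_linear_arg x : linear (rep x).
Proof.
move=> k f g; rewrite rep.unlock /word_lin scaler_sumr -big_split; apply: eq_bigr => m _ /=.
by rewrite foldr_mult_linear scalerDr !scalerA mulrC.
Qed.

Lemma rep_word w f : rep (word K w) f = foldr mult f w.
Proof. by rewrite rep.unlock word_lin_word. Qed.

Lemma repM x y f : rep (x * y) f = rep x (rep y f).
Proof.
move: x y; apply: bilinear_word_ext => [x|y|x|y|w w'].
- by move=> k y z; rewrite mull_linear rep_linear.
- by move=> k x z; rewrite mulr_linear rep_linear.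
- by move=> k y z; rewrite rep_linear rep_linear_arg.
- by move=> k x z; rewrite rep_linear.
- by rewrite -word_cat !rep_word foldr_cat.
Qed.

Lemma rep_gen j f : rep (gen K j) f = mult j f.
Proof. by rewrite rep_word. Qed.

Lemma model_map_linear : linear model_map.
Proof. exact: rep_linear. Qed.

Lemma model_mapD x y : model_map (x + y) = model_map x + model_map y.
Proof. exact: linear_funD model_map_linear _ _. Qed.

Lemma model_mapZ k x : model_map (k *: x) = k *: model_map x.
Proof. exact: linear_funZ model_map_linear _ _. Qed.

Lemma model_mapM x y : model_map (x * y) = rep x (model_map y).
Proof. exact: repM. Qed.

Lemma model_map_gen_comb k k' i j y y' :
  model_map (k *: (gen K i * y) + k' *: (gen K j * y')) =
  k *: mult i (model_map y) + k' *: mult j (model_map y').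
Proof.
have mapZM c l z : model_map (c *: (gen K l * z)) = c *: mult l (model_map z).
  by rewrite -rep_gen -model_mapM; exact: model_mapZ.
by rewrite -2!mapZM; exact: model_mapD.
Qed.

Lemma model_map_gen_comb1 k i j y y' :
  model_map (k *: (gen K i * y) + gen K j * y') =
  k *: mult i (model_map y) + mult j (model_map y').
Proof.
have := model_map_gen_comb k 1 i j y y'.
by rewrite [1 *: mult j _]scale1r => <-; congr (model_map (_ + _)); rewrite scale1r.
Qed.

Lemma mult_dirac j a : mult j (dirac a) = qS q j (unit_wt j + a) *: dirac (unit_wt j + a).
Proof.
apply/funext => b; rewrite msZ /mult_op /dirac subr_eq addrC.
by case: eqP => [->|_]; rewrite ?mulr0.
Qed.

Lemma model_map_word w : model_map (word K w) = word_coef w *: dirac (content w).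
Proof.
rewrite /model_map rep_word; elim: w => [|j w IH] /=.
  by rewrite content_nil scale1r.
rewrite IH (linear_funZ (mult_op_linear q j)) mult_dirac scalerA mulrC.
by rewrite content_cons.
Qed.

Lemma model_map_cons j w : model_map (word K (j :: w)) = mult j (model_map (word K w)).
Proof. by rewrite /model_map !rep_word. Qed.

Lemma model_map_wordE w a : model_map (word K w) a = (a == content w)%:R * word_coef w.
Proof. by rewrite model_map_word msZ mulrC. Qed.

Lemma modelK_dirac l a : modelK q l (dirac a) = q ^ pairing l a *: dirac a.
Proof.
apply/funext => b; rewrite msZ /modelK /dirac.
by case: eqP => [->//|_]; rewrite !mulr0.
Qed.

(** Agreement with the counit in degree 0: the coefficient of E_i vanishes at the exponent 0. *)
Lemma modelE_dirac0 i : modelE q i (dirac 0) = 0.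
Proof.
apply/funext => b; rewrite /modelE /dirac subr_eq0; case: eqP => [->|_].
  by rewrite subrr /raise_coef /qX !mxE expr0z expr1n invr1 subrr mulr0 !mul0r.
by rewrite mulr0.
Qed.

Lemma modelF_dirac0 i : modelF q i (dirac 0) = 0.
Proof.
apply/funext => b; rewrite /modelF /dirac addr_eq0; case: eqP => [->|_].
  by rewrite addNr /lower_coef /qX !mxE expr0z expr1n invr1 subrr mulr0 !mul0r.
by rewrite mulr0.
Qed.

Lemma model_map_nil : model_map (word K [::]) = dirac 0.
Proof. by rewrite model_map_word content_nil scale1r. Qed.

Lemma std_K (l : weight) (j : 'I_d) : actK std l (delta_mx 0 j) = q ^ l 0 j *: delta_mx 0 j.
Proof.
apply/rowP => k; rewrite !mxE eqxx; case: eqP => [->//|_].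
by rewrite !mulr0.
Qed.

Lemma std_E (i : 'I_d.-1) (j : 'I_d) :
  actE std i (delta_mx 0 j) = (j == hi i)%:R *: delta_mx 0 (lo i) :> 'rV[K]_d.
Proof.
rewrite /= -rowE; apply/rowP => k; rewrite !mxE eqxx -!val_eqE /= /bump /= add1n.
by rewrite -natrM mulnb.
Qed.

Lemma std_F (i : 'I_d.-1) (j : 'I_d) :
  actF std i (delta_mx 0 j) = (j == lo i)%:R *: delta_mx 0 (hi i) :> 'rV[K]_d.
Proof.
rewrite /= -rowE; apply/rowP => k; rewrite !mxE eqxx -!val_eqE /= /bump /= add1n.
by rewrite -natrM mulnb.
Qed.

Lemma emb1_std_E (i : 'I_d.-1) (j : 'I_d) :
  emb1 (actE std i (delta_mx 0 j)) = (j == hi i)%:R *: gen K (lo i).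
Proof. by rewrite std_E (linear_funZ (@emb1_linear K d)) emb1_delta. Qed.

Lemma emb1_std_F (i : 'I_d.-1) (j : 'I_d) :
  emb1 (actF std i (delta_mx 0 j)) = (j == lo i)%:R *: gen K (hi i).
Proof. by rewrite std_F (linear_funZ (@emb1_linear K d)) emb1_delta. Qed.

Lemma emb1_std_K l j :
  emb1 (actK std l (delta_mx 0 j)) = q ^ l 0 j *: gen K j.
Proof. by rewrite std_K (linear_funZ (@emb1_linear K d)) emb1_delta. Qed.

Lemma wordE_nil i : wordE std i [::] = 0. Proof. by []. Qed.
Lemma wordF_nil i : wordF std i [::] = 0. Proof. by []. Qed.

Lemma wordE_cons (i : 'I_d.-1) (j : 'I_d) w : wordE std i (j :: w) =
  (j == hi i)%:R *: (gen K (lo i) * word K w) +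
  qX q j (alpha i) *: (gen K j * wordE std i w).
Proof.
rewrite -[LHS]/(emb1 (actE std i (delta_mx 0 j)) * word K w +
  emb1 (actK std (alpha i) (delta_mx 0 j)) * wordE std i w).
exact: mul_scale_add (emb1_std_E i j) (emb1_std_K (alpha i) j).
Qed.

Lemma wordF_cons (i : 'I_d.-1) (j : 'I_d) w : wordF std i (j :: w) =
  (j == lo i)%:R *: (gen K (hi i) * wordK std (- alpha i) w) + gen K j * wordF std i w.
Proof.
rewrite -[LHS]/(emb1 (actF std i (delta_mx 0 j)) * wordK std (- alpha i) w +
  gen K j * wordF std i w).
exact: mul_scale_add1 (emb1_std_F i j).
Qed.

Lemma wordK_word l w : wordK std l w = q ^ pairing l (content w) *: word K w.
Proof.
elim: w => [|j w IH].
  by rewrite /wordK big_nil content_nil pairing0r scale1r word_nil.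
rewrite /wordK big_cons -/(wordK _ _ _) IH emb1_std_K word_cons content_cons.
by rewrite pairingDr pairing_unit expfzDr// -scalerAl scale_mulr scalerA.
Qed.

Lemma tens_linE i : linear (actE tens i). Proof. exact: word_lin_linear. Qed.
Lemma tens_linF i : linear (actF tens i). Proof. exact: word_lin_linear. Qed.
Lemma tens_linK l : linear (actK tens l). Proof. exact: word_lin_linear. Qed.

Lemma tens_E_word i w : actE tens i (word K w) = wordE std i w.
Proof. exact: word_lin_word. Qed.
Lemma tens_F_word i w : actF tens i (word K w) = wordF std i w.
Proof. exact: word_lin_word. Qed.
Lemma tens_K_word l w : actK tens l (word K w) = q ^ pairing l (content w) *: word K w.
Proof. by rewrite -wordK_word; exact: word_lin_word. Qed.

Lemma model_mapK l x : model_map (actK tens l x) = modelK q l (model_map x).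
Proof.
move: x; apply: linear_word_ext => [||w].
- exact: comp_linear model_map_linear (tens_linK l).
- exact: comp_linear (modelK_linear q l) model_map_linear.
rewrite tens_K_word (linear_funZ model_map_linear) model_map_word.
rewrite (linear_funZ (modelK_linear q l)) modelK_dirac !scalerA.
by rewrite mulrC.
Qed.

(** On words, [wordE_cons] and [modelE_mult] are the same recursion, both reflecting the
    coproduct. *)
Lemma model_mapE i x : model_map (actE tens i x) = modelE q i (model_map x).
Proof.
move: x; apply: linear_word_ext => [||w].
- exact: comp_linear model_map_linear (tens_linE i).
- exact: comp_linear (modelE_linear q i) model_map_linear.
rewrite tens_E_word; elim: w => [|j w IH].
  by rewrite wordE_nil model_map_nil modelE_dirac0 (linear_fun0 model_map_linear).
rewrite wordE_cons; apply: etrans (model_map_gen_comb _ _ _ _ _ _) _.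
by rewrite IH model_map_cons modelE_mult.
Qed.

Lemma model_mapF i x : model_map (actF tens i x) = modelF q i (model_map x).
Proof.
move: x; apply: linear_word_ext => [||w].
- exact: comp_linear model_map_linear (tens_linF i).
- exact: comp_linear (modelF_linear q i) model_map_linear.
rewrite tens_F_word; elim: w => [|j w IH].
  by rewrite wordF_nil model_map_nil modelF_dirac0 (linear_fun0 model_map_linear).
rewrite wordF_cons; apply: etrans (model_map_gen_comb1 _ _ _ _ _) _.
rewrite IH model_map_cons modelF_mult//; congr (_ *: mult _ _ + _).
by rewrite -model_mapK tens_K_word wordK_word.
Qed.

End TensorAlgebraModel.

(** The relations u = q v and v = q^-1 u differ by a nonzero scalar, so they generate the same
    ideal. *)
Lemma sub_scale_inv (K : fieldType) (V : lmodType K) (q : K) (u v : V) : q != 0 ->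
  u - q *: v = (- q) *: (v - q^-1 *: u).
Proof.
by move=> q0; rewrite scalerBr scalerA mulNr divff// scaleN1r opprK addrC scaleNr.
Qed.

Lemma id_sub_linear (K : fieldType) (V : lmodType K) (f : V -> V) :
  linear f -> linear (fun x => x - f x).
Proof. by move=> fl k u v; rewrite fl scalerBr opprD addrACA. Qed.

(** * The quotient algebra embeds into the model *)

Section QuotientModel.
Variables (K : fieldType) (q : K) (n : nat).
Hypotheses (q_neq0 : q != 0) (q_sq_neq1 : q ^+ 2 != 1).
Local Notation d := n.+1.
Local Notation weight := (weight d).
Local Notation T := (freealg K 'I_d).
Local Notation P := (model_space K n).
Local Notation std := (std_action q d).
Local Notation tens := (tensor_algebra_action std).
Local Notation model_map := (@model_map K q n).
Local Notation wc := (@word_coef K q n).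
Implicit Types (w : seq 'I_d) (x y : T) (f : P).

Lemma tpow_wordE i w : tpow (size w) (wordE std i w).
Proof.
elim: w => [|j w IH]; first by case: (@tpow_closed K d 0).
rewrite wordE_cons; have Tl := @tpow_closed K d (size w).+1.
apply: (lin_closedD Tl); apply: (lin_closedZ _ Tl); apply: (tpowM (tpow_word _ [:: _])).
  exact: tpow_word.
exact: IH.
Qed.

Lemma tpow_wordF i w : tpow (size w) (wordF std i w).
Proof.
elim: w => [|j w IH]; first by case: (@tpow_closed K d 0).
rewrite wordF_cons; have Tl := @tpow_closed K d (size w).+1.
apply: (lin_closedD Tl); last exact: (tpowM (tpow_word _ [:: _]) IH).
apply: (lin_closedZ _ Tl); apply: (tpowM (tpow_word _ [:: _])).
by rewrite wordK_word//; apply: lin_closedZ (tpow_word _ _); exact: tpow_closed.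
Qed.

Lemma tpow_actE i k x : tpow k x -> tpow k (actE tens i x).
Proof.
move: x; apply: tpow_ind => [|w <-].
  exact (lin_closed_preim (@tens_linE K q n i) (@tpow_closed K d k)).
by have := tpow_wordE i w; rewrite -tens_E_word.
Qed.

Lemma tpow_actF i k x : tpow k x -> tpow k (actF tens i x).
Proof.
move: x; apply: tpow_ind => [|w <-].
  exact (lin_closed_preim (@tens_linF K q n i) (@tpow_closed K d k)).
by have := tpow_wordF i w; rewrite -tens_F_word.
Qed.

Lemma tpow_actK l k x : tpow k x -> tpow k (actK tens l x).
Proof.
move: x; apply: tpow_ind => [|w <-].
  exact (lin_closed_preim (@tens_linK K q n l) (@tpow_closed K d k)).
have := lin_closedZ (q ^ pairing l (content w)) (@tpow_closed K d _) (tpow_word K w).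
by rewrite -tens_K_word.
Qed.

Definition ord_leq : rel 'I_d := relpre val leq.
Definition sort_word w := sort ord_leq w.

Lemma sort_word_perm w : perm_eq (sort_word w) w.
Proof. by rewrite perm_sort. Qed.

Lemma sort_word_sorted w : sorted ord_leq (sort_word w).
Proof. by apply: sort_sorted => i j; exact: leq_total. Qed.

Lemma sorted_content_inj w w' : sorted ord_leq w -> sorted ord_leq w' ->
  content w = content w' -> w = w'.
Proof.
move=> sw sw' /content_inj.
have tr : transitive ord_leq by move=> i j k; exact: leq_trans.
have anti : antisymmetric ord_leq.
  by move=> i j; rewrite /ord_leq /= -eqn_leq => /eqP/val_inj.
exact: (sorted_eq tr anti).
Qed.

Variable G : set T.
Hypothesis G_rel : forall i j : 'I_d, (i < j)%N ->
  G (gen K j * gen K i - q^-1 *: (gen K i * gen K j)).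
Hypothesis G_rep : forall g f, G g -> rep q g f = 0.

(** Here [G_rep] puts the ideal inside the kernel; [G_rel] gives the reverse inclusion in
    [model_map_ideal]. The argument thus applies to any relations that contain the q-commutations
    and act by zero. *)
Lemma ideal_model_map x : x \in ideal G -> model_map x = 0.
Proof.
move: x; apply: ideal_sub; first exact (linear_ker_closed (@model_map_linear K q n)).
move=> a g b Gg /=; rewrite model_mapM repM (G_rep _ Gg).
exact (linear_fun0 (@rep_linear_arg K q n a)).
Qed.

Lemma swap_cong (i j : 'I_d) : scalar_cong G (gen K i * gen K j) (gen K j * gen K i).
Proof.
case: (ltngtP i j) => [ij|ji|/val_inj ->]; last exact: scalar_cong_refl.
  exists q => //.
  have -> : gen K i * gen K j - q *: (gen K j * gen K i) =
            (- q) *: (gen K j * gen K i - q^-1 *: (gen K i * gen K j)).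
    exact: sub_scale_inv.
  exact: (idealZ _ (ideal_gen (G_rel ij))).
exists q^-1; first by rewrite invr_eq0.
exact: (ideal_gen (G_rel ji)).
Qed.

Lemma word_perm_ideal w w' : perm_eq w w' ->
  word K w - (wc w / wc w') *: word K w' \in ideal G.
Proof.
move=> ww; have [c c0 cI] := scalar_cong_word_perm swap_cong ww.
(* Reordering yields an unknown scalar; evaluating the model at the common content of the two words
   identifies it. *)
suff -> : wc w / wc w' = c by exact: cI.
have := congr1 (fun f : P => f (content w)) (ideal_model_map cI).
rewrite (linear_funB (@model_map_linear K q n)) (linear_funZ (@model_map_linear K q n)).
rewrite !msE !model_map_wordE -(content_perm ww) eqxx !mul1r => /eqP.
by rewrite subr_eq0 => /eqP ->; rewrite mulfK// word_coef_neq0.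
Qed.

Definition normal_form x : T :=
  word_lin (fun w => (wc w / wc (sort_word w)) *: word K (sort_word w)) x.

Lemma normal_form_ideal x : x - normal_form x \in ideal G.
Proof.
apply: (@lin_closed_words _ _ [set x | x - normal_form x \in ideal G]).
  exact (lin_closed_preim (id_sub_linear (word_lin_linear _)) (ideal_closed G)).
move=> w /=; rewrite /normal_form word_lin_word; apply: word_perm_ideal.
by rewrite perm_sym sort_word_perm.
Qed.

Lemma mcoeff_linear (m : {fmonom 'I_d}) : linear (fun x : T => x@_m : K^o).
Proof. by move=> k x y; rewrite mcoeffD mcoeffZ. Qed.

Lemma eval_linear (a : weight) : linear (fun f : P => f a : K^o).
Proof. by []. Qed.

(** A sorted word is determined by its content, so each coefficient of the normal form is read off
    from a single value of the model function. An element of the kernel therefore has normal form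
    0. *)
Lemma normal_form_coef x m : (normal_form x)@_m =
  (sorted ord_leq (fmonom_val m))%:R / wc (fmonom_val m) *
    model_map x (content (fmonom_val m)).
Proof.
set t := fmonom_val m; set c := _ / _.
have fl : linear (fun x : T => (normal_form x)@_m : K^o).
  exact (comp_linear (mcoeff_linear m) (word_lin_linear _)).
have gl : linear (fun x : T => c * model_map x (content t) : K^o).
  move=> k y z; rewrite (@model_map_linear K q n) !msE mulrDr mulrCA.
  by [].
apply: (linear_word_ext fl gl) => w /=.
rewrite /normal_form word_lin_word mcoeffZ mcoeff_word model_map_wordE /c -/t.
case: (eqVneq (sort_word w) t) => [wt|wt].
  rewrite -wt sort_word_sorted (content_perm (sort_word_perm w)) eqxx.
  by rewrite !mul1r mulr1 mulrC.
rewrite mulr0; case: (boolP (sorted _ t)) => [st|]; last by rewrite !mul0r.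
case: eqP => [tw|]; last by rewrite mul0r mulr0.
case/eqP: wt; apply: sorted_content_inj => //; first exact: sort_word_sorted.
by rewrite (content_perm (sort_word_perm w)).
Qed.

Lemma model_map_ideal x : model_map x = 0 -> x \in ideal G.
Proof.
move=> x0; have nf0 : normal_form x = 0.
  by apply/malgP => m; rewrite normal_form_coef x0 ms0 mulr0 mcoeff0.
by have := normal_form_ideal x; rewrite nf0 subr0.
Qed.

Local Notation Q := (quotalg G).
Local Notation pi := (@quot_proj K 'I_d G).

Definition quot_model (y : Q) : P := model_map (repr y).

Lemma quot_model_pi x : quot_model (pi x) = model_map x.
Proof.
apply/eqP; rewrite -subr_eq0 /quot_model -(linear_funB (@model_map_linear K q n)); apply/eqP.
by apply: ideal_model_map; apply/quot_projP; rewrite repr_proj.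
Qed.

Lemma quot_model_inj : injective quot_model.
Proof.
move=> y z yz; rewrite -[y]repr_proj -[z]repr_proj; apply/quot_projP.
apply: model_map_ideal; rewrite (linear_funB (@model_map_linear K q n)).
by apply/eqP; rewrite subr_eq0; apply/eqP.
Qed.

Lemma quot_model_linear : linear quot_model.
Proof.
move=> k y z; rewrite -[y]repr_proj -[z]repr_proj -quot_proj_linear.
by rewrite !quot_model_pi model_map_linear.
Qed.

Definition quot_action : Uq_action d Q := UqAction
  (fun i (y : Q) => pi (actE tens i (repr y)))
  (fun i (y : Q) => pi (actF tens i (repr y)))
  (fun l (y : Q) => pi (actK tens l (repr y))).

Lemma quot_model_equiv : equivariant quot_action (model_action q n) quot_model.
Proof.
split=> [i y|i y|l y]; rewrite [LHS]quot_model_pi.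
- exact: model_mapE.
- exact: model_mapF.
- exact: model_mapK.
Qed.

(** [quot_action] acts on chosen representatives. Independence of the choice follows because both
    sides have the same image under the injective [quot_model]. *)
Lemma quot_proj_equiv : equivariant tens quot_action pi.
Proof.
have [eE eF eK] := quot_model_equiv.
split=> [i x|i x|l x]; apply: quot_model_inj; rewrite [LHS]quot_model_pi.
- by rewrite eE quot_model_pi; exact: model_mapE.
- by rewrite eF quot_model_pi; exact: model_mapF.
- by rewrite eK quot_model_pi; exact: model_mapK.
Qed.

Lemma quot_action_is_module : is_Uq_module q quot_action.
Proof.
apply: is_Uq_module_pullback quot_model_linear quot_model_inj quot_model_equiv _.
exact: model_is_Uq_module.
Qed.

End QuotientModel.

(** * Irreducibility of the graded components *)

Section GradedComponents.
Import Order.TTheory Num.Theory.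
Variables (K : fieldType) (q : K) (n : nat).
Hypotheses (q_neq0 : q != 0) (q_inf : forall m, (0 < m)%N -> q ^+ m != 1).
Local Notation d := n.+1.
Local Notation weight := (weight d).
Local Notation T := (freealg K 'I_d).
Local Notation P := (model_space K n).
Local Notation std := (std_action q d).
Local Notation tens := (tensor_algebra_action std).
Local Notation model_map := (@model_map K q n).
Local Notation wc := (@word_coef K q n).
Variable G : set T.
Hypothesis G_rel : forall i j : 'I_d, (i < j)%N ->
  G (gen K j * gen K i - q^-1 *: (gen K i * gen K j)).
Hypothesis G_rep : forall g (f : P), G g -> rep q g f = 0.
Local Notation Q := (quotalg G).
Local Notation pi := (@quot_proj K 'I_d G).
Local Notation act := (@quot_action K q n G).
Local Notation quot_model := (@quot_model K q n G).
Implicit Types (w : seq 'I_d) (x : T) (f : P).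

Let q_sq_neq1 : q ^+ 2 != 1. Proof. exact: q_inf. Qed.
Let pi_equiv := quot_proj_equiv q_neq0 q_sq_neq1 G_rel G_rep.
Let modelP := quot_model_equiv q_neq0 q_sq_neq1 G_rep.
Let quot_model_pi := quot_model_pi G_rep.
Let model_inj : injective quot_model := quot_model_inj q_neq0 G_rel G_rep.
Let model_lin : linear quot_model := quot_model_linear G_rep.
Let pi_lin : linear pi := @quot_proj_linear K 'I_d G.

Let piE i x : act.(actE) i (pi x) = pi (actE tens i x).
Proof. by case: pi_equiv => h _ _; rewrite h. Qed.
Let piF i x : act.(actF) i (pi x) = pi (actF tens i x).
Proof. by case: pi_equiv => _ h _; rewrite h. Qed.
Let piK l x : act.(actK) l (pi x) = pi (actK tens l x).
Proof. by case: pi_equiv => _ _ h; rewrite h. Qed.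

Let model_E i y : quot_model (act.(actE) i y) = modelE q i (quot_model y).
Proof. by case: modelP => h _ _; exact: h. Qed.
Let model_F i y : quot_model (act.(actF) i y) = modelF q i (quot_model y).
Proof. by case: modelP => _ h _; exact: h. Qed.

Definition graded_comp k : set Q := pi @` tpow k.

Lemma graded_comp_closed k : lin_closed (graded_comp k).
Proof.
have [T0 TS] := @tpow_closed K d k; split.
  by exists 0 => //; exact: linear_fun0 pi_lin.
move=> c _ _ [x xk <-] [y yk <-]; exists (c *: x + y); first exact: TS.
exact: pi_lin.
Qed.

Lemma graded_comp_submodule k : submodule act (graded_comp k).
Proof.
have [C0 CS] := graded_comp_closed k; split=> //.
- by move=> i _ [x xk <-]; rewrite piE; exists (actE tens i x) => //; exact: tpow_actE.
- by move=> i _ [x xk <-]; rewrite piF; exists (actF tens i x) => //; exact: tpow_actF.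
- by move=> l _ [x xk <-]; rewrite piK; exists (actK tens l x) => //; exact: tpow_actK.
Qed.

Lemma graded_comp_ind k (N : set Q) : lin_closed N ->
  (forall w, size w = k -> N (pi (word K w))) -> graded_comp k `<=` N.
Proof.
move=> Nl Nw _ [x xk <-]; move: x xk; apply: tpow_ind => //.
exact (lin_closed_preim pi_lin Nl).
Qed.

Lemma quot_model_word w : quot_model (pi (word K w)) = wc w *: dirac K (content w).
Proof. by rewrite quot_model_pi model_map_word. Qed.

Lemma graded_comp_weights k (y : Q) : graded_comp k y ->
  lspan [set u | graded_comp k u /\ exists m, weight_vector q act m u] y.
Proof.
apply: graded_comp_ind => [|w wk]; first exact: lspan_closed.
apply: lspan_incl; split; first by exists (word K w) => //; rewrite -wk; exact: tpow_word.
exists (content w) => l; rewrite piK.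
apply: etrans (congr1 pi (tens_K_word q_neq0 l w)) _.
exact: linear_funZ pi_lin _ _.
Qed.

Definition sorted_words k : {set k.-tuple 'I_d} :=
  [set t : k.-tuple 'I_d | sorted (@ord_leq n) t]%SET.

Lemma graded_comp_dim k : has_dim (graded_comp k) #|sorted_words k|.
Proof.
pose t (i : 'I_#|sorted_words k|) : seq 'I_d := tval (enum_val i).
have tS i : sorted (@ord_leq n) (t i) by have := enum_valP i; rewrite inE.
exists (fun i => pi (word K (t i))) => [c c0 i|y].
  (* Distinct sorted words have distinct contents, so evaluating at one content isolates one
     coefficient. *)
  have := congr1 (fun y => quot_model y (content (t i))) c0.
  rewrite (linear_fun_sum model_lin) (linear_fun0 model_lin) ms0.
  rewrite (linear_fun_sum (@eval_linear K n (content (t i)))) (bigD1 i)//= big1.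
    rewrite (linear_funZ model_lin) quot_model_word !msZ /dirac eqxx mulr1 addr0.
    by move/eqP; rewrite mulf_eq0 (negPf (word_coef_neq0 q_neq0 _)) orbF => /eqP.
  move=> j ji; rewrite (linear_funZ model_lin) quot_model_word !msZ /dirac.
  case: eqP => [e|_]; last by rewrite !mulr0.
  case/eqP: ji; apply/enum_val_inj/val_inj/esym; exact: sorted_content_inj e.
split=> [|[c ->]]; last first.
  apply: lin_closed_sum => [|i _]; first exact: graded_comp_closed.
  apply: lin_closedZ; first exact: graded_comp_closed.
  by exists (word K (t i)) => //; have := @tpow_word K d (t i); rewrite size_tuple.
move: y; apply: graded_comp_ind => [|w wk].
  split=> [|c _ _ [e ->] [e' ->]].
    by exists (fun=> 0); rewrite big1// => i _; rewrite scale0r.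
  exists (fun i => c * e i + e' i); rewrite scaler_sumr -big_split.
  by apply: eq_bigr => i _; rewrite scalerDl scalerA.
have sk : size (sort_word w) == k by rewrite size_sort wk.
have sS : Tuple sk \in sorted_words k by rewrite inE; exact: sort_word_sorted.
pose i0 := enum_rank_in sS (Tuple sk).
have ti0 : t i0 = sort_word w by rewrite /t enum_rankK_in.
exists (fun i => if i == i0 then wc w / wc (sort_word w) else 0).
rewrite (bigD1 i0)//= eqxx [X in _ + X]big1 ?addr0 => [|j /negPf ->]; last first.
  by rewrite scale0r.
apply: model_inj; rewrite (linear_funZ model_lin) !quot_model_word ti0.
by rewrite (content_perm (sort_word_perm w)) scalerA divfK// word_coef_neq0.
Qed.

Lemma graded_comp_in_Of k : in_Of q act (graded_comp k).
Proof.
split; first exact: graded_comp_submodule.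
  by exists #|sorted_words k|; exact: graded_comp_dim.
exact: graded_comp_weights.
Qed.

Definition top_word k : seq 'I_d := nseq k ord0.

Lemma content_top k : content (top_word k) = omega1 d *+ k.
Proof.
elim: k => [|k IH]; first exact: content_nil.
rewrite /top_word /= content_cons -/(top_word k) IH mulrS; congr (_ + _).
by apply/rowP => j; rewrite !mxE eqxx /= natz.
Qed.

Lemma content_top_hi k i : content (top_word k) 0 (hi i) = 0.
Proof.
rewrite content_count; congr Posz; apply/eqP; rewrite -leqn0 leqNgt -has_count.
by apply/hasPn => j /nseqP[-> _].
Qed.

Lemma top_word_uniq w : (forall i, content w 0 (hi i) = 0) -> w = top_word (size w).
Proof.
move=> w0; apply/all_pred1P/allP => j jw /=.
case: (unliftP ord0 j) => [i ji|->//].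
have := w0 i; rewrite content_count -[hi i]ji => -[] /eqP.
by rewrite -leqn0 leqNgt -has_count has_pred1 jw.
Qed.

Lemma modelE_dirac (i : 'I_d.-1) (a : weight) :
  modelE q i (dirac K a) = raise_coef q i a *: dirac K (a + alpha i).
Proof.
apply/funext => b; rewrite msZ /modelE /dirac subr_eq.
by case: eqP => [->|_]; rewrite ?mulr0// addrK.
Qed.

Lemma modelF_dirac (i : 'I_d.-1) (a : weight) :
  modelF q i (dirac K a) = lower_coef q i a *: dirac K (a - alpha i).
Proof.
apply/funext => b; rewrite msZ /modelF /dirac.
rewrite -[b == a - _](inj_eq (addIr (alpha i))) subrK.
by case: eqP => [->|_]; rewrite ?mulr0.
Qed.

Let gap : 1 - q ^- 2 != 0.
Proof. by rewrite subr_eq0 eq_sym invr_eq1. Qed.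

Lemma qX_sq_eq1 (j : 'I_d) (a : weight) : qX q j a ^- 2 = 1 -> a 0 j = 0.
Proof.
rewrite /qX => /eqP; rewrite invr_eq1 exprnP exprz_exp => /eqP /(exprz_eq1 q_inf)/eqP.
by rewrite mulf_eq0 orbF => /eqP.
Qed.

(** Up to a nonzero factor the coefficient is the quantum integer [a_(i+1)], and [m] vanishes only
    for m = 0 when q is not a root of unity. *)
Lemma raise_coef_eq0 (i : 'I_d.-1) (a : weight) : raise_coef q i a = 0 <-> a 0 (hi i) = 0.
Proof.
split=> [/eqP|a0].
  rewrite !mulf_eq0 invr_eq0 (negPf gap) (negPf (qX_neq0 q_neq0 _ _)) /= orbF.
  by rewrite subr_eq0 eq_sym => /eqP/qX_sq_eq1.
by rewrite /raise_coef {2}/qX a0 expr0z expr1n invr1 subrr mulr0 mul0r.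
Qed.

Lemma lower_coef_neq0 (i : 'I_d.-1) (a : weight) : a 0 (lo i) != 0 -> lower_coef q i a != 0.
Proof.
move=> a0; rewrite !mulf_neq0 ?invr_neq0 ?qX_neq0//.
by rewrite subr_eq0 eq_sym; apply: contra a0 => /eqP/qX_sq_eq1/eqP.
Qed.

Lemma top_word_hw k :
  [/\ graded_comp k (pi (word K (top_word k))), pi (word K (top_word k)) <> 0,
      weight_vector q act (omega1 d *+ k) (pi (word K (top_word k))) &
      forall i, act.(actE) i (pi (word K (top_word k))) = 0].
Proof.
split.
- exists (word K (top_word k)) => //.
  by have := @tpow_word K d (top_word k); rewrite size_nseq.
- move=> /(congr1 (fun y => quot_model y (content (top_word k)))).
  rewrite quot_model_word (linear_fun0 model_lin) msZ ms0 /dirac eqxx mulr1 => /eqP.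
  by rewrite (negPf (word_coef_neq0 q_neq0 _)).
- move=> l; rewrite piK -content_top.
  apply: etrans (congr1 pi (tens_K_word q_neq0 l _)) _.
  exact: linear_funZ pi_lin _ _.
- move=> i; apply: model_inj; apply: etrans (model_E i _) _; rewrite quot_model_word.
  apply: etrans (linear_funZ (@modelE_linear K q n i) _ _) _.
  rewrite modelE_dirac (raise_coef_eq0 i _).2; last exact: content_top_hi.
  by rewrite scale0r scaler0; exact: esym (linear_fun0 model_lin).
Qed.

(** A measure that every E_i decreases by one ([height_alpha]) and that is nonnegative on contents,
    so repeated raising must stop. *)
Definition height (a : weight) : int := \sum_(j < d) (j : nat)%:Z * a 0 j.

Lemma heightD a b : height (a + b) = height a + height b.
Proof. by rewrite -big_split; apply: eq_bigr => j _; rewrite mxE mulrDr. Qed.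

Lemma height_unit j : height (unit_wt j) = (j : nat)%:Z.
Proof.
rewrite /height (bigD1 j)//= mxE !eqxx mulr1 big1 ?addr0// => k kj.
by rewrite mxE eqxx (negPf kj) mulr0.
Qed.

Lemma heightB a b : height (a - b) = height a - height b.
Proof. by apply/eqP; rewrite eq_sym subr_eq -heightD subrK. Qed.

Lemma height_alpha i : height (@alpha d i) = -1.
Proof.
by rewrite alphaE heightB !height_unit /= /bump /= add1n -addn1 PoszD opprD addrA subrr.
Qed.

Lemma height_content w : (0 <= height (content w))%R.
Proof.
elim: w => [|j w IH]; last by rewrite content_cons heightD height_unit addr_ge0.
by rewrite content_nil /height big1// => j _; rewrite mxE mulr0.
Qed.

Lemma model_map_supp k x a : tpow k x -> model_map x a != 0 ->
  exists2 w, size w = k & a = content w.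
Proof.
move=> xk; move: x xk; apply: tpow_ind => [|w wk].
  split=> [|c u v Nu Nv]; first by rewrite (linear_fun0 (@model_map_linear K q n)) ms0 eqxx.
  rewrite (@model_map_linear K q n) !msE; have [->|/Nu//] := eqVneq (model_map u a) 0.
  by rewrite mulr0 add0r; exact: Nv.
rewrite model_map_wordE; case: (a =P content w) => [->|_]; last by rewrite mul0r eqxx.
by move=> _; exists w.
Qed.

Lemma model_space_neq0 f : f <> 0 -> exists a, f a != 0.
Proof.
move=> f0; apply: contrapT => nf; apply: f0; apply/funext => a.
by apply/eqP; apply: contrapT => /negP fa; apply: nf; exists a.
Qed.

Section Submodules.
Variables (k : nat) (N : set Q).
Hypothesis N_sub : submodule act N.

Let N_lin : lin_closed N. Proof. by case: N_sub. Qed.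

(** The bound [h] limits the number of raising steps. A nonzero E_i x replaces [x] and has smaller
    height; if all E_i x vanish, [x] is itself a multiple of the top word. *)
Lemma submodule_top h x : tpow k x -> model_map x <> 0 -> N (pi x) ->
  (forall a, model_map x a != 0 -> (height a < h%:Z)%R) ->
  N (pi (word K (top_word k))).
Proof.
elim: h x => [|h IH] x xk x0 Nx xh.
  have [a xa] := model_space_neq0 x0; have [w wk aw] := model_map_supp xk xa.
  by have := xh _ xa; rewrite aw ltNge height_content.
have [[i Ex0]|Ex0] := pselect (exists i, model_map (actE tens i x) <> 0).
  apply: (IH (actE tens i x)) => //; first exact: tpow_actE.
    by rewrite -piE; case: N_sub => _ _ NE _ _; exact: NE.
  move=> b; rewrite model_mapE// /modelE mulf_eq0 negb_or => /andP[_ xb].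
  have := xh _ xb; rewrite heightB height_alpha opprK -addn1 PoszD.
  by rewrite ltrD2r.
(* E_i sends distinct monomials to multiples of distinct monomials, so no cancellation occurs: each
   monomial of [x] is killed by every E_i, and only x_1^k has this property. *)
have supp a : model_map x a != 0 -> a = content (top_word k).
  move=> xa; have [w wk aw] := model_map_supp xk xa.
  rewrite aw -wk -top_word_uniq// => i; rewrite -aw; apply/raise_coef_eq0.
  apply: contrapT => ca; apply: Ex0; exists i => /(congr1 (fun f : P => f (a + alpha i))).
  rewrite model_mapE// /modelE addrK ms0 => /eqP; rewrite mulf_eq0 (negPf xa) orbF.
  by move/eqP.
set a0 := content (top_word k) in supp.
have xa0 : model_map x a0 != 0.
  by have [a xa] := model_space_neq0 x0; rewrite -(supp _ xa).
have -> : pi (word K (top_word k)) = (wc (top_word k) / model_map x a0) *: pi x.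
  apply: model_inj; rewrite (linear_funZ model_lin) quot_model_word quot_model_pi.
  apply/funext => a; rewrite !msZ /dirac -/a0; case: eqP => [->|aa0].
    by rewrite mulr1 divfK.
  have [->|/supp//] := eqVneq (model_map x a) 0.
  by rewrite !mulr0.
exact: lin_closedZ.
Qed.

(** Induction on the sum of the indices of the letters, which is 0 only for the top word. *)
Lemma submodule_words w : N (pi (word K (top_word k))) -> size w = k ->
  N (pi (word K w)).
Proof.
move=> Ntop; have [h] := ubnP (\sum_(j <- w) (j : nat))%N.
elim: h w => // h IH w; rewrite ltnS => wh wk.
have [/all_pred1P ->|] := boolP (all (pred1 ord0) w); first by rewrite wk.
case/allPn => j jw /= j0; case: (unliftP ord0 j) j0 => [i ji _|->]; last by rewrite eqxx.
case/splitPr: jw wh wk => u v; rewrite ji -/(hi i) => wh wk.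
(* Replacing [hi i] by [lo i] decreases the sum by one. F_i may act on several letters of [w'], but
   all resulting words are proportional to [w1] in the quotient, with nonzero total coefficient. *)
set w' := u ++ lo i :: v; set w1 := u ++ hi i :: v.
have Nw' : N (pi (word K w')).
  apply: IH; last by rewrite -wk !size_cat.
  apply: leq_trans wh; rewrite !big_cat !big_cons /= /bump /= add1n.
  by rewrite addnCA [ltnRHS]addnCA addSn.
have wE : content w1 = content w' - alpha i.
  rewrite /w1 /w' !content_cat !content_cons alphaE opprB -!addrA; congr (_ + _).
  by rewrite [RHS]addrCA [unit_wt (lo i) + _]addrC subrK addrC.
have cw0 : lower_coef q i (content w') != 0.
  apply: lower_coef_neq0; rewrite content_count /w' count_cat /= eqxx.
  by rewrite addnCA.
have -> : pi (word K w1) =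
    (wc w1 / (lower_coef q i (content w') * wc w')) *: act.(actF) i (pi (word K w')).
  apply: model_inj; rewrite (linear_funZ model_lin) model_F !quot_model_word.
  rewrite (linear_funZ (@modelF_linear K q n i)) modelF_dirac -wE !scalerA; congr (_ *: _).
  by rewrite -mulrA [wc w' * _]mulrC divfK// mulf_neq0// word_coef_neq0.
by apply: lin_closedZ => //; case: N_sub => _ _ _ NF _; exact: NF.
Qed.

End Submodules.

Lemma graded_comp_irreducible k : irreducible act (graded_comp k).
Proof.
split; first exact: graded_comp_submodule.
  by have [? ? _ _] := top_word_hw k; exists (pi (word K (top_word k))).
move=> N N_sub NC; have [N0|N0] := pselect (N `<=` [set 0]).
  left; apply/seteqP; split=> // y /= ->; by case: N_sub.
right; apply/seteqP; split=> //.
have [y Ny y0] : exists2 y, N y & y <> 0.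
  apply: contrapT => h; apply: N0 => y Ny; apply: contrapT => y0; apply: h.
  by exists y.
have [x xk xy] := NC _ Ny.
have Nl : lin_closed N by case: N_sub.
apply: graded_comp_ind => // w wk; apply: (submodule_words N_sub) wk.
have xk' : tpow k x by exact: xk.
(* A crude bound on heights: each letter occurs at most [k] times in a word of length [k]. *)
pose h := (\sum_(j < d) (j : nat) * k)%N.
apply: (submodule_top (h := h.+1) N_sub xk').
- by move=> x0; apply: y0; apply: model_inj; rewrite -xy quot_model_pi x0 (linear_fun0 model_lin).
- by rewrite xy.
move=> a xa; have [v vk ->] := model_map_supp xk' xa.
rewrite -addn1 PoszD ltzD1 /h -natz natr_sum; apply: ler_sum => j _.
rewrite content_count natrM !natz ler_wpM2l// lez_nat -vk; exact: count_size.
Qed.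

Lemma graded_comp_simple k : simple_of_hw q act (graded_comp k) (omega1 d *+ k).
Proof.
split; [exact: graded_comp_in_Of|exact: graded_comp_irreducible|].
by exists (pi (word K (top_word k))); exact: top_word_hw.
Qed.

End GradedComponents.

(** * The braiding on the standard module *)

Section StandardModule.
Variables (K : fieldType) (q : K) (n : nat).
Hypotheses (q_neq0 : q != 0) (q_inf : forall m, (0 < m)%N -> q ^+ m != 1).
Local Notation d := n.+1.
Local Notation weight := (weight d).
Local Notation T := (freealg K 'I_d).
Local Notation P := (model_space K n).
Local Notation std := (std_action q d).
Local Notation tens_alg := (tensor_algebra_action std).
Local Notation V := 'rV[K]_d.
Local Notation e j := (delta_mx 0 j : V).

Let q_sq_neq1 : q ^+ 2 != 1. Proof. exact: q_inf. Qed.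

Lemma linear_row_ext m (M : lmodType K) (f g : 'rV[K]_m -> M) : linear f -> linear g ->
  (forall j, f (delta_mx 0 j) = g (delta_mx 0 j)) -> f =1 g.
Proof.
move=> fl gl fg u; rewrite [u]row_sum_delta (linear_fun_sum fl) (linear_fun_sum gl).
by apply: eq_bigr => j _; rewrite (linear_funZ fl) (linear_funZ gl) fg.
Qed.

Lemma linear_mx_ext m p (M : lmodType K) (f g : 'M[K]_(m, p) -> M) : linear f -> linear g ->
  (forall i j, f (delta_mx i j) = g (delta_mx i j)) -> f =1 g.
Proof.
move=> fl gl fg X; rewrite [X]matrix_sum_delta (linear_fun_sum fl) (linear_fun_sum gl).
apply: eq_bigr => i _; rewrite (linear_fun_sum fl) (linear_fun_sum gl).
by apply: eq_bigr => j _; rewrite (linear_funZ fl) (linear_funZ gl) fg.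
Qed.

Lemma std_linE i : linear (actE std i).
Proof. by move=> k u v; rewrite /= mulmxDl -scalemxAl. Qed.

Lemma std_linF i : linear (actF std i).
Proof. by move=> k u v; rewrite /= mulmxDl -scalemxAl. Qed.

Lemma std_linK l : linear (actK std l).
Proof. by move=> k u v; apply/rowP => j; rewrite !mxE mulrDr mulrCA. Qed.

Lemma emb1_stdE i v : emb1 (actE std i v) = actE tens_alg i (emb1 v).
Proof.
move: v; apply: linear_row_ext => [||j].
- exact (comp_linear (@emb1_linear K d) (std_linE i)).
- exact (comp_linear (@tens_linE K q n i) (@emb1_linear K d)).
apply: etrans (emb1_std_E q i j) _; apply: esym; rewrite emb1_delta.
apply: etrans (tens_E_word q i [:: j]) (etrans (wordE_cons q i j [::]) _).
exact: mul_scale_add_unit (word_nil _ _) (wordE_nil q i).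
Qed.

Lemma emb1_stdF i v : emb1 (actF std i v) = actF tens_alg i (emb1 v).
Proof.
move: v; apply: linear_row_ext => [||j].
- exact (comp_linear (@emb1_linear K d) (std_linF i)).
- exact (comp_linear (@tens_linF K q n i) (@emb1_linear K d)).
apply: etrans (emb1_std_F q i j) _; apply: esym; rewrite emb1_delta.
apply: etrans (tens_F_word q i [:: j]) (etrans (wordF_cons q i j [::]) _).
by apply: mul_scale_add_unit1 (wordF_nil q i); rewrite /wordK big_nil.
Qed.

Lemma emb1_stdK l v : emb1 (actK std l v) = actK tens_alg l (emb1 v).
Proof.
move: v; apply: linear_row_ext => [||j].
- exact (comp_linear (@emb1_linear K d) (std_linK l)).
- exact (comp_linear (@tens_linK K q n l) (@emb1_linear K d)).
apply: etrans (emb1_std_K q l j) _; apply: esym; rewrite emb1_delta.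
apply: etrans (tens_K_word q_neq0 l [:: j]) _.
by rewrite content_cons content_nil addr0 pairing_unit.
Qed.

(** Realises V as the degree-one part of the model, from which [std_is_module] is deduced. *)
Definition std_model (v : V) : P := model_map q (emb1 v).

Lemma std_model_linear : linear std_model.
Proof. exact (comp_linear (@model_map_linear K q n) (@emb1_linear K d)). Qed.

Lemma std_model_eval v j : std_model v (unit_wt j) = word_coef q [:: j] * v 0 j.
Proof.
have fl : linear (fun v => std_model v (unit_wt j) : K^o).
  exact (comp_linear (@eval_linear K n (unit_wt j)) std_model_linear).
have gl : linear (fun v : V => word_coef q [:: j] * v 0 j : K^o).
  by move=> k u u'; rewrite !mxE mulrDr mulrCA.
apply: (linear_row_ext fl gl) => k.
rewrite /std_model emb1_delta model_map_wordE content_cons content_nil addr0 mxE eqxx.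
have -> : (unit_wt j == unit_wt k) = (j == k).
  apply/eqP/eqP => [/(congr1 (fun a : weight => a 0 k))|->//].
  by rewrite !mxE !eqxx /= eq_sym; case: eqP.
by case: eqP => [->|_]; rewrite ?mulr1 ?mul1r ?mulr0 ?mul0r.
Qed.

Lemma std_model_inj : injective std_model.
Proof.
move=> u v uv; apply/rowP => j; apply: (mulfI (word_coef_neq0 q_neq0 [:: j])).
by rewrite -!std_model_eval uv.
Qed.

Lemma std_is_module : is_Uq_module q std.
Proof.
apply: (is_Uq_module_pullback std_model_linear std_model_inj)
  (model_is_Uq_module n q_neq0 q_sq_neq1).
split=> [i v|i v|l v]; rewrite /std_model.
- by rewrite emb1_stdE; exact: model_mapE.
- by rewrite emb1_stdF; exact: model_mapF.
- by rewrite emb1_stdK; exact: model_mapK.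
Qed.

Lemma std_weight j : weight_vector q std (unit_wt j) (e j).
Proof. by move=> l; rewrite std_K pairing_unit. Qed.

Lemma std_in_Of : in_Of q std setT.
Proof.
split=> //.
  exists d, (fun j => e j) => [c c0 j|u].
    have := congr1 (fun u : V => u 0 j) c0; rewrite summxE (bigD1 j)//= big1 => [|k kj].
      by rewrite !mxE !eqxx mulr1 addr0.
    by rewrite !mxE eqxx eq_sym (negPf kj) mulr0.
  by split=> // _; exists (fun j => u 0 j); rewrite -row_sum_delta.
move=> u _; rewrite [u]row_sum_delta; apply: lin_closed_sum => [|j _].
  exact: lspan_closed.
apply: lspanZ; apply: lspan_incl; split=> //; exists (unit_wt j); exact: std_weight.
Qed.

Lemma mul_lin1_mx m p (f : 'rV[K]_m -> 'rV[K]_p) u : linear f -> u *m lin1_mx f = f u.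
Proof.
move=> fl; move: u; apply: linear_row_ext => // [k u v|j].
  by rewrite mulmxDl -scalemxAl.
by rewrite -rowE; apply/rowP => k; rewrite !mxE.
Qed.

Lemma tens_rank1 m p (f : 'rV[K]_m -> 'rV[K]_m) (g : 'rV[K]_p -> 'rV[K]_p) u v :
  linear f -> linear g -> tens f g (u^T *m v) = (f u)^T *m g v.
Proof.
by move=> fl gl; rewrite /tens mulmxA -trmx_mul -mulmxA !mul_lin1_mx.
Qed.

Lemma delta_rank1 (i j : 'I_d) : delta_mx i j = (e i)^T *m e j.
Proof. by rewrite trmx_delta mul_delta_mx. Qed.

Lemma tens_linear m p (f : 'rV[K]_m -> 'rV[K]_m) (g : 'rV[K]_p -> 'rV[K]_p) :
  linear (tens f g).
Proof. by move=> k X Y; rewrite /tens mulmxDr mulmxDl -scalemxAr -scalemxAl. Qed.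

Lemma tens_delta (f g : V -> V) i j : linear f -> linear g ->
  tens f g (delta_mx i j) = (f (e i))^T *m g (e j).
Proof. by move=> fl gl; rewrite delta_rank1 tens_rank1. Qed.

Lemma rank1E (u v : V) r s : (u^T *m v) r s = u 0 r * v 0 s.
Proof. by rewrite !mxE big_ord1 !mxE. Qed.

Lemma rank1ZZ a b (u v : V) : (a *: u)^T *m (b *: v) = (a * b) *: (u^T *m v).
Proof. by apply/matrixP => r s; rewrite [RHS]mxE !rank1E !mxE mulrACA. Qed.

Lemma rank1Zl a (u v : V) : (a *: u)^T *m v = a *: (u^T *m v).
Proof. by rewrite -{1}[v]scale1r rank1ZZ mulr1. Qed.

Lemma rank1Zr a (u v : V) : u^T *m (a *: v) = a *: (u^T *m v).
Proof. by rewrite -{1}[u]scale1r rank1ZZ mul1r. Qed.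

Lemma foldr_linear (J : Type) (f : J -> V -> V) (s : seq J) :
  (forall i, linear (f i)) -> linear (fun u => foldr f u s).
Proof. by move=> fl; elim: s => // i s IH k u v /=; rewrite IH fl. Qed.

(** Each F moves a basis vector up by exactly one index or kills it, so the length of the word fixes
    the target index. *)
Lemma foldr_stdF (s : seq 'I_d.-1) i r :
  foldr (actF std) (e i) s 0 r != 0 -> r = (i + size s)%N :> nat.
Proof.
elim: s r => [|k s IH] r.
  by rewrite /= mxE eqxx /= addn0; case: (eqVneq r _) => [->|_]//; rewrite eqxx.
rewrite /= mxE => /eqP h; apply: contrapT => ne; apply: h; apply: big1 => j _.
rewrite mxE; case: andP => [[/eqP jk /eqP rk]|_]; last by rewrite mulr0.
apply/eqP; rewrite mulr1; apply: contrapT => /negP/IH jE.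
by apply: ne; rewrite rk -jk jE addnS.
Qed.

Lemma foldr_stdE (s : seq 'I_d.-1) j r :
  foldr (actE std) (e j) s 0 r != 0 -> (r + size s)%N = j :> nat.
Proof.
elim: s r => [|k s IH] r.
  by rewrite /= mxE eqxx /= addn0; case: (eqVneq r _) => [->|_]//; rewrite eqxx.
rewrite /= mxE => /eqP h; apply: contrapT => ne; apply: h; apply: big1 => i _.
rewrite mxE; case: andP => [[/eqP jk /eqP rk]|_]; last by rewrite mulr0.
apply/eqP; rewrite mulr1; apply: contrapT => /negP/IH jE.
by apply: ne; rewrite -jE rk jk addnS.
Qed.

Lemma R0_unique R0 R0' : is_R0 q std std R0 -> is_R0 q std std R0' -> R0 =1 R0'.
Proof.
move=> [l0 h0] [l0' h0']; apply: linear_mx_ext => // i j.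
rewrite delta_rank1 (h0 _ _ _ _ (std_weight i) (std_weight j)).
by rewrite (h0' _ _ _ _ (std_weight i) (std_weight j)).
Qed.

Lemma R0_entry R0 X r s : is_R0 q std std R0 -> R0 X r s = (if r == s then q else 1) * X r s.
Proof.
move=> [l0 h0].
have fl : linear (fun X : 'M[K]_d => R0 X r s : K^o).
  by move=> k Y Z; rewrite l0 !mxE.
have gl : linear (fun X : 'M[K]_d => (if r == s then q else 1) * X r s : K^o).
  by move=> k Y Z; rewrite !mxE mulrDr mulrCA.
move: X; apply: (linear_mx_ext fl gl) => i j.
rewrite {1}delta_rank1 (h0 _ _ _ _ (std_weight i) (std_weight j)) -delta_rank1.
rewrite pairing_unit !mxE eqxx /=.
case: (eqVneq r i) => [->|_]; last by rewrite !mulr0.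
case: (eqVneq s j) => [->|_]; last by rewrite !mulr0.
by rewrite eq_sym; case: eqP.
Qed.

(** * The R-matrix on the tensor square of V *)

Section RMatrix.
Variables (Theta : R_series K d) (Rmx : 'M[K]_d -> 'M[K]_d).
Hypothesis Theta_univ : universal_R q Theta.
Hypothesis RmxP : is_Rmatrix q Theta std std Rmx.

Lemma R1_unique R1 R1' : is_R1 Theta std std R1 -> is_R1 Theta std std R1' -> R1 =1 R1'.
Proof.
move=> [N h] [N' h'] X; rewrite (h (maxn N N')) ?leq_maxl//.
by rewrite (h' (maxn N N')) ?leq_maxr.
Qed.

(** Universality provides an equivariant operator of the same form R_0 R_1; by uniqueness of both
    factors it is [Rmx]. *)
Lemma Rmx_equiv : equivariant (tens_action std std) (tens_action_op std std) Rmx.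
Proof.
case: Theta_univ => _ /(_ d d std std std_is_module std_in_Of std_is_module std_in_Of).
move=> [R' [R0' [R1' [h0' h1' ->]]] eq'].
case: RmxP => R0 [R1 [h0 h1 ->]].
suff -> : R0 \o R1 = R0' \o R1' by [].
by apply/funext => X /=; rewrite (R1_unique h1 h1') (R0_unique h0 h0').
Qed.

(** The degree-[k] term of R_1 applies [k] of the F on the left and [k] of the E on the right, so it
    can only send (i, j) to (i + k, j - k). *)
Lemma R1_term_entry k i j r s : R1_term Theta std std k (delta_mx i j) r s != 0 ->
  r = (i + k)%N :> nat /\ (s + k)%N = j :> nat.
Proof.
move=> h; apply: contrapT => ne; move/eqP: h; apply; rewrite summxE; apply: big1 => I _.
rewrite summxE; apply: big1 => J _.
rewrite mxE tens_delta; [|exact: foldr_linear std_linF|exact: foldr_linear std_linE].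
rewrite rank1E; apply/eqP; apply: contrapT => /negP.
rewrite !mulf_eq0 !negb_or => /and3P[_ /foldr_stdF rE /foldr_stdE sE].
by apply: ne; rewrite rE -sE !size_tuple.
Qed.

Lemma R1_term0 X : R1_term Theta std std 0 X = X.
Proof.
case: Theta_univ => T0 _; rewrite /R1_term (big_pred1 [tuple]) => [|t]; last first.
  by rewrite /= tuple0; apply/esym/eqP.
rewrite (big_pred1 [tuple]) => [|t]; last by rewrite /= tuple0; apply/esym/eqP.
have id1 : lin1_mx (fun u : V => u) = 1%:M.
  by apply/matrixP => i j; rewrite !mxE eqxx /= eq_sym.
by rewrite T0 scale1r /tens /= id1 trmx1 mul1mx mulmx1.
Qed.

Lemma Rmx_linear : linear Rmx.
Proof.
case: RmxP => R0 [R1 [[l0 _] [N h1] ->]] k X Y /=.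
rewrite -l0; congr (R0 _); rewrite !(h1 N)//.
rewrite scaler_sumr -big_split; apply: eq_bigr => m _ /=.
rewrite /R1_term scaler_sumr -big_split; apply: eq_bigr => I _ /=.
rewrite scaler_sumr -big_split; apply: eq_bigr => J _ /=.
by rewrite tens_linear scalerDr !scalerA mulrC.
Qed.

(** Only the degree-0 term of R_1 leaves the indices in place, so the entry is that of R_0. *)
Lemma Rmx_entry_diag (i j : 'I_d) : Rmx (delta_mx i j) i j = if i == j then q else 1.
Proof.
case: RmxP => R0 [R1 [h0 [N h1] ->]] /=; rewrite (R0_entry _ _ _ h0) (h1 N.+1)//.
rewrite big_ord_recl R1_term0 mxE mxE !eqxx /= summxE big1 ?addr0 ?mulr1// => k _.
apply/eqP; apply: contrapT => /negP/R1_term_entry[]/eqP.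
by rewrite -[X in X == _]addn0 eqn_add2l.
Qed.

Lemma Rmx_entry_lower (i j r s : 'I_d) : (r < i)%N -> Rmx (delta_mx i j) r s = 0.
Proof.
move=> ri; case: RmxP => R0 [R1 [h0 [N h1] ->]] /=; rewrite (R0_entry _ _ _ h0) (h1 N)//.
rewrite summxE big1 ?mulr0// => k _.
apply/eqP; apply: contrapT => /negP/R1_term_entry[rE _].
by rewrite rE ltnNge leq_addr in ri.
Qed.

Lemma tens_KK_delta (l : weight) (i j : 'I_d) :
  tens (actK std l) (actK std l) (delta_mx i j) = q ^ (l 0 i + l 0 j) *: delta_mx i j.
Proof.
rewrite tens_delta; [|exact: std_linK|exact: std_linK].
by rewrite !std_K rank1ZZ -delta_rank1 expfzDr.
Qed.

Lemma tens_KK_entry (l : weight) X (r s : 'I_d) :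
  tens (actK std l) (actK std l) X r s = q ^ (l 0 r + l 0 s) * X r s.
Proof.
have kl : linear (fun X => tens (actK std l) (actK std l) X r s : K^o).
  by move=> c Y Z; rewrite tens_linear !mxE.
have kr : linear (fun X : 'M[K]_d => q ^ (l 0 r + l 0 s) * X r s : K^o).
  by move=> c Y Z; rewrite !mxE mulrDr mulrCA.
apply: (linear_mx_ext kl kr) => a b; rewrite tens_KK_delta !mxE.
case: (eqVneq r a) => [->|_]; last by rewrite !mulr0.
by case: (eqVneq s b) => [->|_]; rewrite ?mulr0.
Qed.

Lemma Rmx_K l X : Rmx (tens (actK std l) (actK std l) X) =
  tens (actK std l) (actK std l) (Rmx X).
Proof. by case: Rmx_equiv => _ _ eK; exact: eK. Qed.

(** R commutes with every K_l, and q^z determines z; taking l = e_k compares the k-th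
    coordinates. *)
Lemma Rmx_entry_weight (i j r s : 'I_d) : Rmx (delta_mx i j) r s != 0 ->
  unit_wt i + unit_wt j = unit_wt r + unit_wt s.
Proof.
move=> h; apply/rowP => k.
have := congr1 (fun X : 'M[K]_d => X r s) (Rmx_K (unit_wt k) (delta_mx i j)).
rewrite /= tens_KK_delta tens_KK_entry (linear_funZ Rmx_linear) mxE.
move=> /(mulIf h)/(exprz_inj q_neq0 q_inf).
by rewrite !mxE !eqxx /= !(eq_sym k).
Qed.

Lemma unit_wt_pair (i j r s : 'I_d) : unit_wt i + unit_wt j = unit_wt r + unit_wt s ->
  (r == i) && (s == j) || (r == j) && (s == i).
Proof.
move=> ijrs; have : content [:: i; j] = content [:: r; s].
  by rewrite !content_cons content_nil !addr0.
move/content_inj => pe; move: (perm_mem pe i) (perm_mem pe j) (perm_mem pe r) (perm_mem pe s).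
rewrite !inE !eqxx ?orbT /= => /esym h1 /esym h2 hr hs.
case/orP: hr => /eqP hr.
  rewrite hr eqxx /=; case/orP: hs => /eqP hs; last by rewrite hs eqxx.
  by move: h2; rewrite hr hs orbb => /eqP ->; rewrite eqxx.
rewrite hr eqxx /=; case/orP: hs => /eqP hs; first by rewrite hs eqxx orbT.
by move: h1; rewrite hr hs orbb => /eqP ->; rewrite !eqxx.
Qed.

(** Weights leave only e_i e_j and e_j e_i, and for i > j the latter is excluded because R_1 never
    decreases the left index. *)
Lemma Rmx_delta (i j : 'I_d) : Rmx (delta_mx i j) =
  (if i == j then q else 1) *: delta_mx i j +
  (if (i < j)%N then Rmx (delta_mx i j) j i else 0) *: delta_mx j i.
Proof.
apply/matrixP => r s; rewrite !mxE.
have [/andP[/eqP -> /eqP ->]|nij] := boolP ((r == i) && (s == j)).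
  rewrite Rmx_entry_diag mulr1; case: ltnP => [ij|_]; last by rewrite mul0r addr0.
  have -> : (i == j) = false by apply/eqP => ije; rewrite ije ltnn in ij.
  by rewrite mulr0 addr0.
rewrite mulr0 add0r.
have [/andP[/eqP rj /eqP si]|nji] := boolP ((r == j) && (s == i)).
  rewrite rj si mulr1; case: ltngtP => // [ji|/val_inj ije].
    by rewrite Rmx_entry_lower.
  by rewrite rj si ije !eqxx in nij.
rewrite mulr0; apply/eqP; apply: contrapT => /negP/Rmx_entry_weight/unit_wt_pair.
by rewrite (negPf nij) (negPf nji).
Qed.

Lemma Rmx_F i X : Rmx (tens (actF std i) (actK std (- alpha i)) X + tens id (actF std i) X) =
  tens (actK std (- alpha i)) (actF std i) (Rmx X) + tens (actF std i) id (Rmx X).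
Proof. by case: Rmx_equiv => _ eF _; exact: eF. Qed.

Let idl : linear (id : V -> V). Proof. by []. Qed.

Lemma tens_FK_delta (k : 'I_d.-1) (l : weight) (i j : 'I_d) :
  tens (actF std k) (actK std l) (delta_mx i j) =
  ((i == lo k)%:R * q ^ l 0 j) *: delta_mx (hi k) j.
Proof.
rewrite tens_delta; [|exact: std_linF|exact: std_linK].
by rewrite std_F std_K rank1ZZ -delta_rank1.
Qed.

Lemma tens_KF_delta (k : 'I_d.-1) (l : weight) (i j : 'I_d) :
  tens (actK std l) (actF std k) (delta_mx i j) =
  ((j == lo k)%:R * q ^ l 0 i) *: delta_mx i (hi k).
Proof.
rewrite tens_delta; [|exact: std_linK|exact: std_linF].
by rewrite std_F std_K rank1ZZ -delta_rank1 mulrC.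
Qed.

Lemma tens_F1_delta (k : 'I_d.-1) (i j : 'I_d) : tens (actF std k) id (delta_mx i j) =
  (i == lo k)%:R *: delta_mx (hi k) j.
Proof.
rewrite tens_delta; [|exact: std_linF|exact: idl].
by rewrite std_F rank1Zl -delta_rank1.
Qed.

Lemma tens_1F_delta (k : 'I_d.-1) (i j : 'I_d) : tens id (actF std k) (delta_mx i j) =
  (j == lo k)%:R *: delta_mx i (hi k).
Proof.
rewrite tens_delta; [|exact: idl|exact: std_linF].
by rewrite std_F rank1Zr -delta_rank1.
Qed.

Lemma lo_lt_hi (k : 'I_d.-1) : (lo k < hi k)%N.
Proof. by rewrite /= /bump /= add1n. Qed.

(** Apply equivariance under F_k to e_lo e_lo. Comparing coefficients of e_hi e_lo, the unknown
    entry x satisfies q^-1 + x = q. *)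
Lemma Rmx_entry_adjacent (k : 'I_d.-1) : Rmx (delta_mx (lo k) (hi k)) (hi k) (lo k) = q - q^-1.
Proof.
have := congr1 (fun X : 'M[K]_d => X (hi k) (lo k)) (Rmx_F k (delta_mx (lo k) (lo k))).
rewrite tens_FK_delta tens_1F_delta (Rmx_delta (lo k) (lo k)) ltnn scale0r addr0.
rewrite !eqxx (linear_funZ (tens_linear _ _)) (linear_funZ (tens_linear _ _)).
rewrite tens_KF_delta tens_F1_delta !eqxx (linear_funD Rmx_linear) !(linear_funZ Rmx_linear).
rewrite (Rmx_delta (hi k) (lo k)) ltnNge (ltnW (lo_lt_hi k)) scale0r addr0.
rewrite !mxE !eqxx hi_lo_neq lo_hi_neq /= !mulr0 !mulr1 !mul1r add0r.
rewrite (ltn_eqF (ltnSn k)) subr0 exprN1 => h.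
by rewrite -[LHS](addrK q^-1) [X in X - _]addrC h.
Qed.

(** Equivariance under F_k on e_i e_(lo k): as F_k kills e_i, only the other index moves and the
    entry is unchanged. *)
Lemma Rmx_entry_step (i : 'I_d) (k : 'I_d.-1) : (i < lo k)%N ->
  Rmx (delta_mx i (hi k)) (hi k) i = Rmx (delta_mx i (lo k)) (lo k) i.
Proof.
move=> ik; have ilo : (i == lo k) = false by apply/eqP => eik; rewrite eik ltnn in ik.
have ihi : (i == hi k) = false.
  by apply/eqP => eik; rewrite eik ltnNge (ltnW (lo_lt_hi k)) in ik.
have := congr1 (fun X : 'M[K]_d => X (hi k) i) (Rmx_F k (delta_mx i (lo k))).
rewrite tens_FK_delta tens_1F_delta ilo mul0r scale0r add0r eqxx scale1r => ->.
rewrite (Rmx_delta i (lo k)) ilo ik scale1r !(linear_funD (tens_linear _ _)).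
rewrite !(linear_funZ (tens_linear _ _)) !tens_KF_delta !tens_F1_delta !eqxx ilo.
rewrite !mxE !eqxx ihi ilo /= ?(eq_sym (hi k)) ?ihi ?hi_lo_neq ?lo_hi_neq /=.
by rewrite !(mulr0, mul0r, mulr1, mul1r, addr0, add0r) andbF add0r.
Qed.

Lemma Rmx_entry_upper (i j : 'I_d) : (i < j)%N -> Rmx (delta_mx i j) j i = q - q^-1.
Proof.
move=> ij; have [m mj] : exists m, m = j :> nat by exists j.
elim: m j mj ij => [|m IH] j mj ij; first by rewrite -mj in ij.
have mn : (m < n)%N by have := ltn_ord j; rewrite -mj.
pose k : 'I_d.-1 := Ordinal mn.
have jhi : j = hi k by apply: val_inj; rewrite /= /bump /= add1n -mj.
rewrite jhi; have := ij; rewrite -mj ltnS leq_eqVlt => /orP[/eqP im|im].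
  have -> : i = lo k by apply: val_inj.
  exact: Rmx_entry_adjacent.
by rewrite Rmx_entry_step//; exact: IH.
Qed.

(** All later sections know the braiding only through this formula, assumed there as [c_entry]. *)
Lemma braiding_entry X (r s : 'I_d) : braiding Rmx X r s =
  (if r == s then q else 1) * X s r + (if (r < s)%N then (q - q^-1) * X r s else 0).
Proof.
rewrite /braiding mxE.
have fl : linear (fun X => Rmx X s r : K^o) by move=> c Y Z; rewrite Rmx_linear !mxE.
have gl : linear (fun X : 'M[K]_d => (if r == s then q else 1) * X s r +
    (if (r < s)%N then (q - q^-1) * X r s else 0) : K^o).
  move=> c Y Z; set a := (if r == s then q else 1).
  rewrite -[RHS]/(c * (a * Y s r + (if (r < s)%N then (q - q^-1) * Y r s else 0)) +
    (a * Z s r + (if (r < s)%N then (q - q^-1) * Z r s else 0))).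
  by rewrite !mxE; case: ifP => _; ring.
apply: (linear_mx_ext fl gl) => i j; rewrite Rmx_delta !mxE.
congr (_ + _).
  have [/andP[/eqP -> /eqP ->]|] := boolP ((s == i) && (r == j)); last by rewrite !mulr0.
  by rewrite eq_sym.
rewrite andbC; have [/andP[/eqP -> /eqP ->]|] := boolP ((r == i) && (s == j)).
  by case: ifP => [ij|_]; rewrite ?mulr1// Rmx_entry_upper.
by rewrite mulr0; case: ifP; rewrite ?mulr0.
Qed.

End RMatrix.

End StandardModule.

(** * Eigenspaces of the braiding *)

Section BraidingEigenspaces.
Variables (K : fieldType) (q : K) (n : nat).
Hypotheses (q_neq0 : q != 0) (q_inf : forall m, (0 < m)%N -> q ^+ m != 1).
Hypothesis two_neq0 : 1 + 1 != 0 :> K.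
Local Notation d := n.+1.
Local Notation T := (freealg K 'I_d).
Variable c : 'M[K]_d -> 'M[K]_d.
Hypothesis c_entry : forall X (r s : 'I_d), c X r s =
  (if r == s then q else 1) * X s r + (if (r < s)%N then (q - q^-1) * X r s else 0).

(** If q^z = -1 then q^(2z) = 1, so z = 0 and 1 = -1. This separates the eigenvalues q^k from the
    eigenvalues -q^k. *)
Lemma exprz_neqN1 (z : int) : q ^ z <> -1.
Proof.
move=> qz; have z0 : z * 2 = 0.
  by apply: (exprz_eq1 q_inf); rewrite -exprz_exp qz -exprnP sqrrN expr1n.
have {z0} z0 : z = 0 by apply/eqP; move/eqP: z0; rewrite mulf_eq0 orbF.
by move: qz; rewrite z0 expr0z => /eqP; rewrite -subr_eq0 opprK (negPf two_neq0).
Qed.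

(** The braiding preserves the pair of entries (r, s), (s, r) and acts on it by a 2 by 2 block with
    characteristic polynomial (l - q)(l + q^-1). *)
Lemma eigen_offdiag l X (r s : 'I_d) : c X = l *: X -> (r < s)%N ->
  X r s = l * X s r /\ [\/ X s r = 0, l = q | l = - q^-1].
Proof.
move=> cX rs; have rsF : (r == s) = false by apply/eqP => e; rewrite e ltnn in rs.
have e1 := congr1 (fun Y : 'M[K]_d => Y s r) cX.
have e2 := congr1 (fun Y : 'M[K]_d => Y r s) cX.
move: e1 e2; rewrite !c_entry !mxE rs ltnNge (ltnW rs) (eq_sym s) rsF /= addr0 !mul1r.
move=> e1; rewrite e1 => e2; split=> //.
have : X s r * ((l - q) * (l + q^-1)) = 0.
  transitivity (l * (l * X s r) - (X s r + (q - q^-1) * (l * X s r))); last first.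
    by rewrite e2 subrr.
  by field.
move/eqP; rewrite !mulf_eq0 subr_eq0 addr_eq0 => /or3P[]/eqP; [exact: Or31|exact: Or32|exact: Or33].
Qed.

Lemma S2P X : S2 q c X <-> forall r s : 'I_d, (r < s)%N -> X s r = q^-1 * X r s.
Proof.
split=> [|h].
  move: X; apply: lspan_sub => [|X [k cX] r s rs].
    split=> [r s _|a X Y hX hY r s rs]; first by rewrite !mxE mulr0.
    by rewrite !mxE hX// hY//; ring.
  have [-> [->|->|h]] := eigen_offdiag cX rs.
  - by rewrite !mulr0.
  - by rewrite mulrA mulVf// mul1r.
  (* An equality q^k = -q^-1 would give q^(k+1) = -1. *)
  - case: (@exprz_neqN1 (k + 1)); rewrite expfzDr// h expr1z.
    by rewrite mulNr mulVf.
(* All of S^2 lies in the eigenspace of q, hence the exponent 1; in [L2P] the eigenvalue is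
   -q^-1. *)
apply: lspan_incl; exists 1; apply/matrixP => r s; rewrite c_entry mxE expr1z.
case: (ltngtP r s) => [rs|sr|/val_inj ->].
- have -> : (r == s) = false by apply/eqP => e; rewrite e ltnn in rs.
  by rewrite h//; field.
- have -> : (r == s) = false by apply/eqP => e; rewrite e ltnn in sr.
  by rewrite (h _ _ sr); field.
- by rewrite eqxx addr0.
Qed.

Lemma L2P X : L2 q c X <-> (forall r, X r r = 0) /\
  forall r s : 'I_d, (r < s)%N -> X r s = - q^-1 * X s r.
Proof.
split=> [|[h0 h]].
  move: X; apply: lspan_sub => [|X [k cX]].
    split=> [|a X Y [hX0 hX] [hY0 hY]].
      by split=> [r|r s _]; rewrite !mxE ?mulr0.
    split=> [r|r s rs]; rewrite !mxE ?hX0 ?hY0 ?mulr0 ?addr0//.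
    by rewrite hX// hY//; ring.
  split=> [r|r s rs].
    (* The braiding multiplies diagonal entries by q, so a nonzero one would force q^(k-1) = -1. *)
    have := congr1 (fun Y : 'M[K]_d => Y r r) cX; rewrite c_entry mxE eqxx ltnn addr0.
    move/eqP; rewrite -subr_eq0 -mulrBl mulf_eq0 => /orP[|/eqP//].
    rewrite opprK addr_eq0 => /eqP qk; case: (@exprz_neqN1 (k - 1)).
    by rewrite expfzDr// exprN1 -[q ^ k]opprK -qk mulNr divff.
  have [-> [->|h|->//]] := eigen_offdiag cX rs.
    by rewrite !mulr0.
  case: (@exprz_neqN1 (k - 1)); rewrite expfzDr// exprN1 -[q ^ k]opprK h.
  by rewrite mulNr divff.
apply: lspan_incl; exists (-1); apply/matrixP => r s; rewrite c_entry mxE exprN1.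
case: (ltngtP r s) => [rs|sr|/val_inj ->].
- have -> : (r == s) = false by apply/eqP => e; rewrite e ltnn in rs.
  by rewrite (h _ _ rs); field.
- have -> : (r == s) = false by apply/eqP => e; rewrite e ltnn in sr.
  by rewrite (h _ _ sr); field.
- by rewrite eqxx h0 !mulr0 addr0.
Qed.

Definition qwedge (i j : 'I_d) : 'M[K]_d := delta_mx j i - q^-1 *: delta_mx i j.

Lemma qwedge_L2 (i j : 'I_d) : (i < j)%N -> L2 q c (qwedge i j).
Proof.
move=> ij; have ijF : (i == j) = false by apply/eqP => e; rewrite e ltnn in ij.
apply/L2P; split=> [r|r s rs]; rewrite !mxE.
  have rF : (r == j) && (r == i) = false.
    by apply/negP => /andP[/eqP -> ji]; rewrite eq_sym ijF in ji.
  by rewrite rF [(r == i) && _]andbC rF mulr0 subr0.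
have -> : (r == j) && (s == i) = false.
  apply/negP => /andP[/eqP rj /eqP si]; rewrite rj si in rs.
  by have := ltn_trans ij rs; rewrite ltnn.
have -> : (s == i) && (r == j) = false.
  apply/negP => /andP[/eqP si /eqP rj]; rewrite rj si in rs.
  by have := ltn_trans ij rs; rewrite ltnn.
by rewrite [(r == i) && _]andbC sub0r mulr0 subr0 mulNr.
Qed.

Lemma sum_pairs (V : zmodType) (F : 'I_d -> 'I_d -> V) : (forall i, F i i = 0) ->
  \sum_(i < d) \sum_(j < d) F i j =
  \sum_(i < d) \sum_(j < d) if (i < j)%N then F i j + F j i else 0.
Proof.
move=> F0; have -> : \sum_(i < d) \sum_(j < d) (if (i < j)%N then F i j + F j i else 0) =
    \sum_(i < d) \sum_(j < d) (if (i < j)%N then F i j else 0) +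
    \sum_(i < d) \sum_(j < d) (if (i < j)%N then F j i else 0).
  rewrite -big_split; apply: eq_bigr => i _; rewrite -big_split; apply: eq_bigr => j _ /=.
  by case: ifP; rewrite ?addr0.
rewrite [X in _ + X]exchange_big -big_split; apply: eq_bigr => i _ /=.
rewrite -big_split; apply: eq_bigr => j _ /=.
by case: (ltngtP i j) => [||/val_inj ->]; rewrite ?addr0 ?add0r ?F0.
Qed.

(** By [L2P] a matrix X of this space is the sum over i < j of X_ji times [qwedge i j]. *)
Lemma L2_ind (N : set 'M[K]_d) : lin_closed N ->
  (forall i j : 'I_d, (i < j)%N -> N (qwedge i j)) -> L2 q c `<=` N.
Proof.
move=> Nl Nw X /L2P[X0 h]; rewrite [X]matrix_sum_delta sum_pairs => [|i]; last first.
  by rewrite X0 scale0r.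
apply: lin_closed_sum => // i _; apply: lin_closed_sum => // j _.
case: ifP => [ij|_]; last by case: Nl.
have -> : X i j *: delta_mx i j + X j i *: delta_mx j i = X j i *: qwedge i j.
  by rewrite (h _ _ ij) scalerBr scalerA mulNr scaleNr addrC mulrC.
by apply: lin_closedZ => //; exact: Nw.
Qed.

Lemma emb2_qwedge i j :
  emb2 (qwedge i j) = gen K j * gen K i - q^-1 *: (gen K i * gen K j).
Proof.
rewrite /qwedge (linear_funB (@emb2_linear K d)) (linear_funZ (@emb2_linear K d)).
by rewrite !emb2_delta.
Qed.

Lemma L2_rel (i j : 'I_d) : (i < j)%N ->
  (@emb2 K d @` L2 q c) (gen K j * gen K i - q^-1 *: (gen K i * gen K j)).
Proof. by move=> ij; exists (qwedge i j); [exact: qwedge_L2|exact: emb2_qwedge]. Qed.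

Lemma L2_rep g (f : model_space K n) : (@emb2 K d @` L2 q c) g -> rep q g f = 0.
Proof.
move=> [X XL <-]; move: X XL; apply: L2_ind => [|i j ij].
  exact (linear_ker_closed (comp_linear (@rep_linear K q n f) (@emb2_linear K d))).
have repMM k l : rep q (gen K k * gen K l) f = mult_op q k (mult_op q l f).
  apply: etrans (repM q _ _ _) (etrans (rep_gen q k _) _).
  exact: congr1 (rep_gen q l f).
rewrite /= emb2_qwedge; apply: etrans (linear_funB (@rep_linear K q n f) _ _) _.
have repZM := etrans (linear_funZ (@rep_linear K q n f) q^-1 _) (congr1 ( *:%R q^-1) (repMM i j)).
apply: etrans (congr2 (fun a b => a - b) (repMM j i) repZM) _.
by rewrite (mult_op_comm q_neq0 f ij) subrr.
Qed.

End BraidingEigenspaces.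

(** The relation [E] is not assumed compatible with adding a letter in front, so the induction
    carries an arbitrary common prefix [p]. *)
Lemma perm_swap_ind (I : eqType) (E : seq I -> seq I -> Prop) :
  (forall w, E w w) -> (forall w1 w2 w3, E w1 w2 -> E w2 w3 -> E w1 w3) ->
  (forall u i j v, E (u ++ [:: i, j & v]) (u ++ [:: j, i & v])) ->
  forall w w', perm_eq w w' -> E w w'.
Proof.
move=> Erefl Etrans Eswap w w' ww; rewrite -[w]cat0s -[w']cat0s.
elim: w [::] w' ww => [|j w IH] p w' ww'.
  by rewrite perm_sym in ww'; move/perm_nilP: ww' => ->; exact: Erefl.
have /splitPr jw' : j \in w' by rewrite -(perm_mem ww') mem_head.
case: jw' ww' => u v; rewrite perm_sym -cat1s perm_catCA perm_cons perm_sym => wuv.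
apply: (Etrans _ (p ++ j :: u ++ v)).
  by rewrite -!cat_rcons; exact: IH.
elim: u p {wuv} => [|k u IHu] p /=; first exact: Erefl.
apply: (Etrans _ (p ++ [:: k, j & u ++ v])); first exact: Eswap.
by rewrite -!(cat_rcons k); exact: IHu.
Qed.

(** * Braided symmetric powers and flatness *)

Section Flatness.
Variables (K : fieldType) (q : K) (n : nat).
Hypotheses (q_neq0 : q != 0) (q_inf : forall m, (0 < m)%N -> q ^+ m != 1).
Hypothesis two_neq0 : 1 + 1 != 0 :> K.
Local Notation d := n.+1.
Local Notation T := (freealg K 'I_d).
Variable c : 'M[K]_d -> 'M[K]_d.
Hypothesis c_entry : forall X (r s : 'I_d), c X r s =
  (if r == s then q else 1) * X s r + (if (r < s)%N then (q - q^-1) * X r s else 0).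
Local Notation wc := (@word_coef K q n).
Implicit Types (x y : T) (u v w : seq 'I_d).

Let c_S2P := S2P q_neq0 q_inf two_neq0 c_entry.

Lemma mcoeff_sum (J : Type) (r : seq J) (A : pred J) (F : J -> T) m :
  (\sum_(i <- r | A i) F i)@_m = \sum_(i <- r | A i) (F i)@_m.
Proof. by apply: (big_morph (mcoeff m)) => [x y|]; rewrite ?mcoeffD ?mcoeff0. Qed.

Definition swap_sym x u v : Prop := forall r s : 'I_d, (r < s)%N ->
  x@_(FMonom (u ++ [:: s, r & v])) = q^-1 * x@_(FMonom (u ++ [:: r, s & v])).

Lemma swap_sym_closed u v : lin_closed [set x | swap_sym x u v].
Proof.
split=> [r s _|k x y hx hy r s rs]; first by rewrite !mcoeff0 mulr0.
by rewrite !mcoeffD !mcoeffZ hx// hy//; ring.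
Qed.

Lemma mcoeff_sandwich a b u v X (r s : 'I_d) : size a = size u ->
  (word K a * emb2 X * word K b)@_(FMonom (u ++ [:: r, s & v])) =
  ((a == u) && (b == v))%:R * X r s.
Proof.
move=> au.
have fl : linear (fun X => (word K a * emb2 X * word K b)@_(FMonom (u ++ [:: r, s & v])) : K^o).
  apply: (@comp_linear _ _ _ _ _ _ (@mcoeff_linear K n _)).
  exact (comp_linear (mulr_linear (word K b))
    (comp_linear (mull_linear (word K a)) (@emb2_linear K d))).
have gl : linear (fun X : 'M[K]_d => ((a == u) && (b == v))%:R * X r s : K^o).
  by move=> k Y Z; rewrite !mxE mulrDr mulrCA.
apply: (linear_mx_ext fl gl) => i j; rewrite emb2_delta -2!word_cat -word_cat.
rewrite mcoeff_word /= -catA eqseq_cat// !eqseq_cons mxE -natrM mulnb; congr (_%:R).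
by rewrite (eq_sym r) (eq_sym s); do !case: (_ == _).
Qed.

(** Turns membership in the intersection of the spaces V^i (x) S^2 (x) V^j into linear conditions on
    pairs of coefficients. *)
Lemma braided_sym_powerP k x : braided_sym_power q c k x <->
  tpow k x /\ forall u v, (size u + 2 + size v = k)%N -> swap_sym x u v.
Proof.
split=> [[xk h]|[xk h]]; split=> //.
  move=> u v uvk; have hx := h _ _ uvk; move: hx; apply: (lspan_sub (swap_sym_closed u v)).
  move=> _ {x xk h} [x [X [y [xu XS yv ->]]]]; move: x xu; apply: tpow_ind => [|a au].
    exact (lin_closed_preim (comp_linear (mulr_linear y) (mulr_linear (emb2 X)))
      (swap_sym_closed u v)).
  move: y yv; apply: tpow_ind => [|b bv].
    exact (lin_closed_preim (mull_linear (word K a * emb2 X)) (swap_sym_closed u v)).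
  move=> r s rs; rewrite !mcoeff_sandwich// ((c_S2P X).1 XS r s rs).
  by rewrite mulrCA.
move=> i j ijk.
(* For the converse, the words of [x] are grouped by prefix [u] and suffix [v]; the coefficients at
   the two middle letters form a matrix, which lies in S^2. *)
pose X (u : i.-tuple 'I_d) (v : j.-tuple 'I_d) : 'M[K]_d :=
  \matrix_(r, s) x@_(FMonom (u ++ [:: r, s & v])).
have S2X (u : i.-tuple 'I_d) (v : j.-tuple 'I_d) : S2 q c (X u v).
  apply/c_S2P => r s rs; rewrite !mxE; apply: (h _ _ _ r s rs).
  by rewrite !size_tuple.
pose F (u : i.-tuple 'I_d) (v : j.-tuple 'I_d)  : T :=
  word K (tval u) * emb2 (X u v) * word K (tval v).
have Fk (u : i.-tuple 'I_d) (v : j.-tuple 'I_d) : tpow k (F u v).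
  have := tpowM (tpowM (tpow_word K u) (tpow_emb2 (X u v))) (tpow_word K v).
  by rewrite !size_tuple ijk.
have -> : x = \sum_u \sum_v F u v.
  apply/malgP => m; apply: esym.
  rewrite mcoeff_sum.
  have sumE (u : i.-tuple 'I_d) : (\sum_v F u v)@_m = \sum_v (F u v)@_m.
    exact: mcoeff_sum.
  have [mk|mk] := eqVneq (size (fmonom_val m)) k; last first.
    have -> : x@_m = 0.
      by apply/eqP; apply: contraNT mk => /((tpowP k x).1 xk) ->.
    apply: big1 => u _; rewrite sumE; apply: big1 => v _.
    by apply/eqP; apply: contraNT mk => /((tpowP k _).1 (Fk u v)) ->.
  case: m mk sumE => m /= mk sumE.
  have su : size (take i m) == i by rewrite size_takel// mk -ijk -addnA leq_addr.
  have : size (drop i m) = j.+2 by rewrite size_drop mk -ijk -addnA addKn.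
  case E : (drop i m) => [|r [|s v0]]//= [sv].
  have [u1 u1E] : exists u1 : i.-tuple 'I_d, tval u1 = take i m by exists (Tuple su).
  have [v1 v1E] : exists v1 : j.-tuple 'I_d, tval v1 = v0.
    by have /eqP sv' := sv; exists (Tuple sv').
  have mE : m = u1 ++ [:: r, s & v1] by rewrite u1E v1E -E cat_take_drop.
  rewrite (bigD1 u1)//= [X in _ + X]big1 ?addr0 => [|u uu]; last first.
    rewrite sumE; apply: big1 => v _; rewrite /F mE mcoeff_sandwich ?size_tuple//.
    by rewrite val_eqE (negPf uu) mul0r.
  rewrite sumE (bigD1 v1)//= big1 ?addr0 => [|v vv]; last first.
    rewrite /F mE mcoeff_sandwich//.
    by rewrite [X in _ && X]val_eqE (negPf vv) andbF mul0r.
  by rewrite /F mE mcoeff_sandwich// !eqxx mul1r mxE.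
apply: lin_closed_sum => [|u _]; first exact: lspan_closed.
apply: lin_closed_sum => [|v _]; first exact: lspan_closed.
apply: lspan_incl; exists (word K (tval u)), (X u v), (word K (tval v)); split=> //.
  by have := @tpow_word K d u; rewrite size_tuple.
by have := @tpow_word K d v; rewrite size_tuple.
Qed.

(** The quotient of the coefficient by [wc] is invariant under adjacent swaps, since both acquire
    the same power of q. *)
Lemma swap_sym_perm k x w w' :
  (forall u v, (size u + 2 + size v = k)%N -> swap_sym x u v) -> size w = k ->
  perm_eq w w' -> x@_(FMonom w) * wc w' = x@_(FMonom w') * wc w.
Proof.
move=> h wk ww'.
(* The swap conditions hold only for words of length [k], so the transitive relation must carry the
   length along. *)
suff : size w = k -> size w' = k /\ x@_(FMonom w) / wc w = x@_(FMonom w') / wc w'.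
  move=> /(_ wk) [_] /eqP; rewrite eqr_div ?word_coef_neq0// => /eqP ->.
  by [].
move: w w' ww' {wk}; apply: perm_swap_ind => [//|w1 w2 w3 h12 h23 k1|u i j v uvk].
  by have [k2 ->] := h12 k1; exact: h23.
split; first by rewrite -uvk !size_cat.
have uvk' : (size u + 2 + size v = k)%N by rewrite -uvk size_cat /= -addnA add2n.
case: (ltngtP i j) => [ij|ji|/val_inj -> //].
  rewrite (h u v uvk' _ _ ij) (word_coef_swap q_neq0 u v ij).
  by rewrite -mulf_div divff ?mul1r// invr_eq0.
rewrite (h u v uvk' _ _ ji) (word_coef_swap q_neq0 u v ji).
by rewrite -mulf_div divff ?mul1r// invr_eq0.
Qed.

(** The q-symmetrisation of the word [t]: the coefficient of each rearrangement is q^(-inv). *)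
Definition sym_basis k (t : k.-tuple 'I_d) : T :=
  \sum_(w : k.-tuple 'I_d | perm_eq w t) wc w *: word K (tval w).

Lemma mcoeff_sym_basis k (t : k.-tuple 'I_d) m :
  (sym_basis t)@_m = if perm_eq (fmonom_val m) t then wc (fmonom_val m) else 0.
Proof.
have termE (w : k.-tuple 'I_d) :
    (wc w *: word K (tval w))@_m = wc w * (tval w == fmonom_val m)%:R.
  by rewrite mcoeffZ mcoeff_word.
rewrite mcoeff_sum (eq_bigr _ (fun (w : k.-tuple 'I_d) _ => termE w)).
case: ifP => mt.
  have mk : size (fmonom_val m) == k by rewrite (perm_size mt) size_tuple.
  rewrite (bigD1 (Tuple mk))//= eqxx mulr1 big1 ?addr0// => w /andP[_ wm].
  have -> : (tval w == fmonom_val m) = false; last by rewrite mulr0.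
  by apply/eqP => e; case/eqP: wm; exact: val_inj.
apply: big1 => w wt; case: eqP => [wm|_]; last by rewrite mulr0.
by rewrite -wm wt in mt.
Qed.

Lemma sym_basis_power k (t : k.-tuple 'I_d) : braided_sym_power q c k (sym_basis t).
Proof.
apply/braided_sym_powerP; split.
  apply/tpowP => m; rewrite mcoeff_sym_basis; case: ifP => [mt _|_]; last by rewrite eqxx.
  by rewrite (perm_size mt) size_tuple.
move=> u v _ r s rs; rewrite !mcoeff_sym_basis /=.
have -> : perm_eq (u ++ [:: s, r & v]) t = perm_eq (u ++ [:: r, s & v]) t.
  by apply: permPl; rewrite perm_cat2l (perm_catCA [:: s] [:: r] v).
by case: ifP => _; [exact: word_coef_swap|rewrite mulr0].
Qed.

Lemma braided_sym_power_closed k : lin_closed (braided_sym_power q c k).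
Proof.
split=> [|a x y /braided_sym_powerP[xk hx] /braided_sym_powerP[yk hy]].
  apply/braided_sym_powerP; split; first by case: (@tpow_closed K d k).
  by move=> u v _; case: (swap_sym_closed u v).
apply/braided_sym_powerP; split; first by case: (@tpow_closed K d k) => _; exact.
by move=> u v uvk; case: (swap_sym_closed u v) => _; apply; [exact: hx|exact: hy].
Qed.

Lemma card_sorted_words k : #|sorted_words n k| = 'C(d + k - 1, k).
Proof.
rewrite addSn subn1 /= addnC -card_sorted_tuples; apply: eq_card => t.
by rewrite !inE sorted_map.
Qed.

(** The coefficients on sorted words can be prescribed freely and determine a tensor of S^k, so the
    count of sorted words gives the dimension. *)
Lemma braiding_flat : flat q c.
Proof.
move=> k; rewrite -card_sorted_words.
pose t (i : 'I_#|sorted_words n k|) : k.-tuple 'I_d := enum_val i.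
have tS i : sorted (@ord_leq n) (t i) by have := enum_valP i; rewrite inE.
have t_inj i j : perm_eq (t i) (t j) -> i = j.
  move=> /content_perm e; apply/enum_val_inj/val_inj; exact: sorted_content_inj e.
have coefE (e : 'I_#|sorted_words n k| -> K) m : (\sum_i e i *: sym_basis (t i))@_m =
    \sum_i e i * (if perm_eq (fmonom_val m) (t i) then wc (fmonom_val m) else 0).
  rewrite mcoeff_sum.
  by apply: eq_bigr => i _; rewrite mcoeffZ mcoeff_sym_basis.
exists (fun i => sym_basis (t i)) => [e e0 i|x].
  have := congr1 (mcoeff (FMonom (t i))) e0; rewrite coefE mcoeff0 (bigD1 i)//= perm_refl.
  rewrite big1 => [|j ji]; last first.
    case: ifP => [/t_inj ij|_]; last by rewrite mulr0.
    by rewrite ij eqxx in ji.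
  by move/eqP; rewrite addr0 mulf_eq0 (negPf (word_coef_neq0 q_neq0 _)) orbF => /eqP.
split=> [/braided_sym_powerP[xk hx]|[e ->]]; last first.
  apply: lin_closed_sum => [|i _]; first exact: braided_sym_power_closed.
  apply: lin_closedZ; [exact: braided_sym_power_closed|exact: sym_basis_power].
exists (fun i => x@_(FMonom (t i)) / wc (t i)); apply/malgP => m; rewrite coefE.
have [mk|mk] := eqVneq (size (fmonom_val m)) k; last first.
  have -> : x@_m = 0 by apply/eqP; apply: contraNT mk => /((tpowP k x).1 xk) ->.
  rewrite big1// => i _; case: ifP => [mt|_]; last by rewrite mulr0.
  by rewrite (perm_size mt) size_tuple eqxx in mk.
have sk : size (sort_word (fmonom_val m)) == k by rewrite size_sort mk.
have sS : Tuple sk \in sorted_words n k by rewrite inE; exact: sort_word_sorted.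
pose i0 := enum_rank_in sS (Tuple sk).
have ti0 : t i0 = Tuple sk by rewrite /t enum_rankK_in.
have pm : perm_eq (fmonom_val m) (t i0) by rewrite ti0 perm_sym; exact: sort_word_perm.
rewrite (bigD1 i0)//= pm big1 ?addr0 => [|j ji]; last first.
  case: ifP => [mt|_]; last by rewrite mulr0.
  have /t_inj ij : perm_eq (t j) (t i0) by rewrite -(permPl mt).
  by rewrite ij eqxx in ji.
have := swap_sym_perm hx mk pm; rewrite fmK => h.
by rewrite mulrAC -h mulfK// word_coef_neq0.
Qed.

End Flatness.

(** * Simple modules with the same highest weight *)

Section EigenSums.
Variables (K : fieldType) (M : lmodType K) (L : M -> M).
Hypothesis L_lin : linear L.

(** Independence of eigenspaces in a form that allows repeated eigenvalues and zero summands in the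
    list. *)
Lemma eigen_sum_eq0 (mu : K) (s : seq (K * M)) y :
  (forall t, t \in s -> L t.2 = t.1 *: t.2 /\ t.1 != mu) ->
  y = \sum_(t <- s) t.2 -> L y = mu *: y -> y = 0.
Proof.
have [k] := ubnP (size s); elim: k s y => // k IH [|t0 s] y.
  by move=> _ _ ->; rewrite big_nil.
rewrite ltnS /= => sk sL yE Ly; have [Lt0 t0mu] := sL _ (mem_head _ _).
have sL' t : t \in s -> L t.2 = t.1 *: t.2 /\ t.1 != mu.
  by move=> ts; apply: sL; rewrite in_cons ts orbT.
(* Applying [L] minus [t0.1] removes the first summand and rescales the others, while it multiplies
   [y] by this nonzero scalar. *)
suff : (mu - t0.1) *: y = 0.
  by move/eqP; rewrite scaler_eq0 subr_eq0 eq_sym (negPf t0mu) => /eqP.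
apply: (IH [seq (t.1, (t.1 - t0.1) *: t.2) | t <- s]).
- by rewrite size_map.
- move=> _ /mapP[t ts ->] /=; have [Lt tmu] := sL' _ ts.
  by rewrite (linear_funZ L_lin) Lt !scalerA mulrC.
- rewrite big_map /= scalerBl -Ly yE big_cons (linear_funD L_lin) (linear_fun_sum L_lin).
  rewrite scalerDr Lt0 opprD addrACA subrr add0r scaler_sumr -sumrB.
  rewrite big_seq [RHS]big_seq; apply: eq_bigr => t ts.
  by have [-> _] := sL' _ ts; rewrite scalerBl.
- by rewrite (linear_funZ L_lin) Ly !scalerA mulrC.
Qed.

End EigenSums.

Section HighestWeightModules.
Variables (K : fieldType) (q : K) (n : nat).
Hypotheses (q_neq0 : q != 0) (q_inf : forall m, (0 < m)%N -> q ^+ m != 1).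
Local Notation d := n.+1.
Local Notation weight := (weight d).

(** Half the sum of the positive roots up to a multiple of (1, ..., 1), shifted to have integer
    entries. It pairs to 1 with each simple root, so K_rho detects how many F_i have been
    applied. *)
Definition rho : weight := \row_j - (j : nat)%:Z.

Lemma pairing_rho (i : 'I_d.-1) : pairing (alpha i) rho = 1.
Proof.
rewrite pairingC pairing_alpha !mxE /= /bump /= add1n -addn1 PoszD opprK.
by rewrite addrC addrAC subrr add0r.
Qed.

Lemma pairing_rho_sum (I : seq 'I_d.-1) :
  pairing rho (\sum_(i <- I) alpha i) = (size I)%:Z.
Proof.
elim: I => [|i I IH]; first by rewrite big_nil pairing0r.
by rewrite big_cons pairingDr IH pairingC pairing_rho /= -add1n PoszD.
Qed.

Section Span.
Variables (M : lmodType K) (a : Uq_action d M) (l : weight) (v : M).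
Hypothesis a_mod : is_Uq_module q a.
Hypotheses (v_wt : weight_vector q a l v) (v_E : forall i, actE a i v = 0).

Definition lower_word (I : seq 'I_d.-1) : M := foldr (actF a) v I.

Definition hw_span : set M := lspan (range lower_word).

Lemma lower_word_weight I :
  weight_vector q a (l - \sum_(i <- I) alpha i) (lower_word I).
Proof.
elim: I => [|i I IH] m /=; first by rewrite big_nil subr0.
rewrite (Uq_KF a_mod) IH (linear_funZ (Uq_linF a_mod i)) scalerA -expfzDr// big_cons.
congr (q ^ _ *: _); rewrite !pairingDr !pairingNr pairingDr (pairingC _ m).
by rewrite opprD addrCA.
Qed.

Lemma hw_span_closed : lin_closed hw_span.
Proof. exact: lspan_closed. Qed.

Lemma hw_span_word I : hw_span (lower_word I).
Proof. by apply: lspan_incl; exists I. Qed.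

Lemma hw_span_F i x : hw_span x -> hw_span (actF a i x).
Proof.
move: x; apply: lspan_sub => [|_ [I _ <-]].
  exact (lin_closed_preim (Uq_linF a_mod i) hw_span_closed).
exact: (hw_span_word (i :: I)).
Qed.

Lemma hw_span_K m x : hw_span x -> hw_span (actK a m x).
Proof.
move: x; apply: lspan_sub => [|_ [I _ <-]].
  exact (lin_closed_preim (Uq_linK a_mod m) hw_span_closed).
rewrite /= lower_word_weight; apply: lin_closedZ; first exact: hw_span_closed.
exact: hw_span_word.
Qed.

(** The commutation relation moves E_i past each F_j, at the cost of terms in K, until E_i meets [v]
    and kills it. *)
Lemma hw_span_E i x : hw_span x -> hw_span (actE a i x).
Proof.
move: x; apply: lspan_sub => [|_ [I _ <-]].
  exact (lin_closed_preim (Uq_linE a_mod i) hw_span_closed).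
elim: I => [|j I IH] /=; first by rewrite v_E; case: hw_span_closed.
rewrite -[actE a i _](subrK (actF a j (actE a i (lower_word I)))) (Uq_EF a_mod).
apply: lin_closedD; [exact: hw_span_closed| |exact: hw_span_F].
apply: lin_closedZ; first exact: hw_span_closed.
rewrite -[- actK a _ _]scaleN1r; apply: lin_closedD; first exact: hw_span_closed.
  exact: (hw_span_K _ (hw_span_word I)).
apply: lin_closedZ; first exact: hw_span_closed.
exact: (hw_span_K _ (hw_span_word I)).
Qed.

Lemma hw_span_submodule : submodule a hw_span.
Proof.
case: hw_span_closed => N0 NS; split=> // [i x|i x|m x].
- exact: hw_span_E.
- exact: hw_span_F.
- exact: hw_span_K.
Qed.

(** K_rho has eigenvalue q^((rho|l) - m) on a word of m lowering operators, so only the empty word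
    contributes to the weight [l]. *)
Lemma hw_span_top x : hw_span x -> weight_vector q a l x -> exists c, x = c *: v.
Proof.
pose mu := q ^ pairing rho l; pose L := actK a rho.
(* Vectors that split into a multiple of [v] and eigenvectors of K_rho for other eigenvalues. *)
pose N : set M := [set x | exists c, exists s : seq (K * M),
     (forall t, t \in s -> L t.2 = t.1 *: t.2 /\ t.1 != mu) /\
     x = c *: v + \sum_(t <- s) t.2].
have spanN : hw_span `<=` N.
  apply: lspan_sub.
    split=> [|k _ _ [c [s [sL ->]]] [c' [s' [sL' ->]]]].
      by exists 0, [::]; split=> //; rewrite big_nil scale0r addr0.
    exists (k * c + c'), ([seq (t.1, k *: t.2) | t <- s] ++ s'); split=> [t|].
      rewrite mem_cat => /orP[/mapP[u us ->]|/sL'//] /=; have [Lu umu] := sL _ us.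
      by rewrite /L (linear_funZ (Uq_linK a_mod rho)) -/L Lu !scalerA mulrC.
    rewrite big_cat big_map /= -scaler_sumr scalerDl scalerDr scalerA.
    by rewrite addrACA.
  move=> _ [[|i I] _ <-].
    by exists 1, [::]; split=> //; rewrite big_nil scale1r addr0.
  pose m := l - \sum_(j <- i :: I) alpha j.
  exists 0, [:: (q ^ pairing rho m, lower_word (i :: I))]; split; last first.
    by rewrite big_seq1 scale0r add0r.
  move=> t; rewrite inE => /eqP -> /=; split; first exact: (lower_word_weight (i :: I)).
  apply/eqP => /(exprz_inj q_neq0 q_inf)/eqP; rewrite /m pairingDr pairingNr.
  by rewrite -subr_eq0 addrAC subrr add0r pairing_rho_sum.
move=> /spanN[c [s [sL xE]]] x_wt; exists c.
suff : x - c *: v = 0 by move/eqP; rewrite subr_eq0 => /eqP.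
apply: (eigen_sum_eq0 (Uq_linK a_mod rho) sL).
  by rewrite xE addrAC subrr add0r.
rewrite (linear_funB (Uq_linK a_mod rho)) (linear_funZ (Uq_linK a_mod rho)) x_wt v_wt.
by rewrite scalerBr !scalerA mulrC.
Qed.

End Span.

Section Product.
Variables (M1 M2 : lmodType K) (a1 : Uq_action d M1) (a2 : Uq_action d M2).
Hypotheses (mod1 : is_Uq_module q a1) (mod2 : is_Uq_module q a2).

Definition prod_action : Uq_action d (M1 * M2)%type := UqAction
  (fun i p => (actE a1 i p.1, actE a2 i p.2))
  (fun i p => (actF a1 i p.1, actF a2 i p.2))
  (fun l p => (actK a1 l p.1, actK a2 l p.2)).

Lemma prod_is_module : is_Uq_module q prod_action.
Proof.
split.
- by move=> i k u v; congr pair; [exact: (Uq_linE mod1)|exact: (Uq_linE mod2)].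
- by move=> i k u v; congr pair; [exact: (Uq_linF mod1)|exact: (Uq_linF mod2)].
- by move=> l k u v; congr pair; [exact: (Uq_linK mod1)|exact: (Uq_linK mod2)].
- by case=> u v; congr pair; [exact: (Uq_K0 mod1)|exact: (Uq_K0 mod2)].
- by move=> l m u; congr pair; [exact: (Uq_KD mod1)|exact: (Uq_KD mod2)].
- by move=> l i u; congr pair; [exact: (Uq_KE mod1)|exact: (Uq_KE mod2)].
- by move=> l i u; congr pair; [exact: (Uq_KF mod1)|exact: (Uq_KF mod2)].
- by move=> i j u; congr pair; [exact: (Uq_EF mod1)|exact: (Uq_EF mod2)].
- by move=> i j u ij; congr pair; [exact: (Uq_SerreE0 mod1)|exact: (Uq_SerreE0 mod2)].
- by move=> i j u ij; congr pair; [exact: (Uq_SerreE1 mod1)|exact: (Uq_SerreE1 mod2)].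
- by move=> i j u ij; congr pair; [exact: (Uq_SerreF0 mod1)|exact: (Uq_SerreF0 mod2)].
- by move=> i j u ij; congr pair; [exact: (Uq_SerreF1 mod1)|exact: (Uq_SerreF1 mod2)].
Qed.

(* The submodule of the product generated by the pair of highest weight vectors is the
   graph of the isomorphism: it meets each factor trivially, since its top weight
   space is a line. *)
Lemma simple_hw_iso (N2 : set M2) (l : weight) :
  irreducible a1 setT -> has_highest_weight q a1 setT l ->
  irreducible a2 N2 -> has_highest_weight q a2 N2 l ->
  isomorphic_to a1 a2 N2.
Proof.
move=> [sub1 _ irr1] [v1 [_ v10 v1_wt v1_E]] [sub2 _ irr2] [v2 [N2v2 v20 v2_wt v2_E]].
have [N20 N2S N2E N2F N2K] := sub2.
pose v : M1 * M2 := (v1, v2).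
have v_wt : weight_vector q prod_action l v.
  by move=> m; congr pair; [exact: v1_wt|exact: v2_wt].
have v_E i : actE prod_action i v = 0 by congr pair; [exact: v1_E|exact: v2_E].
pose N := hw_span prod_action v.
have [N0 NS NE NF NK] : submodule prod_action N.
  exact: (hw_span_submodule prod_is_module v_wt v_E).
have Nv : N v by exact: (hw_span_word prod_action v [::]).
have top := hw_span_top prod_is_module v_wt.
have lin1E i : actE a1 i 0 = 0 := linear_fun0 (Uq_linE mod1 i).
have lin1F i : actF a1 i 0 = 0 := linear_fun0 (Uq_linF mod1 i).
have lin1K m : actK a1 m 0 = 0 := linear_fun0 (Uq_linK mod1 m).
have lin2E i : actE a2 i 0 = 0 := linear_fun0 (Uq_linE mod2 i).
have lin2F i : actF a2 i 0 = 0 := linear_fun0 (Uq_linF mod2 i).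
have lin2K m : actK a2 m 0 = 0 := linear_fun0 (Uq_linK mod2 m).
have N_N2 p : N p -> N2 p.2.
  move: p; apply: lspan_sub => [|_ [I _ <-]].
    by split=> [|k p p' Np Np']; [exact: N20|exact: N2S].
  by elim: I => [//|i I IH]; exact: N2F.
have ker1 x : N (x, 0) -> x = 0.
  pose A := [set x | N (x, 0)].
  have subA : submodule a1 A.
    split=> [|k u w Nu Nw|i u Nu|i u Nu|m u Nu]; first exact: N0.
    - have := NS k _ _ Nu Nw.
      by rewrite -[k *: (u, 0) + (w, 0)]/(k *: u + w, k *: 0 + 0) scaler0 addr0.
    - by have := NE i _ Nu; rewrite /= lin2E.
    - by have := NF i _ Nu; rewrite /= lin2F.
    - by have := NK m _ Nu; rewrite /= lin2K.
  have [A0|A1] := irr1 _ subA (fun _ _ => I).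
    by move=> Nx; have : A x by []; rewrite A0.
  have Av1 : A v1 by rewrite A1.
  (* The pair (v1, 0) would have weight [l], hence be c (v1, v2); as v2 is nonzero, c = 0 and v1 =
     0. *)
  have [|c [c1 c2]] := top _ Av1.
    by move=> m; congr pair; [exact: v1_wt|rewrite /= lin2K scaler0].
  move/esym/eqP: c2; rewrite scaler_eq0 => /orP[/eqP c0|/eqP//].
  by case: v10; rewrite c1 c0 scale0r.
have ker2 y : N (0, y) -> y = 0.
  pose B := [set y | N (0, y)].
  have subB : submodule a2 B.
    split=> [|k u w Nu Nw|i u Nu|i u Nu|m u Nu]; first exact: N0.
    - have := NS k _ _ Nu Nw.
      by rewrite -[k *: (0, u) + (0, w)]/(k *: 0 + 0, k *: u + w) scaler0 addr0.
    - by have := NE i _ Nu; rewrite /= lin1E.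
    - by have := NF i _ Nu; rewrite /= lin1F.
    - by have := NK m _ Nu; rewrite /= lin1K.
  have BN2 : B `<=` N2 by move=> z Bz; exact: (N_N2 _ Bz).
  have [B0|B1] := irr2 _ subB BN2.
    by move=> Ny; have : B y by []; rewrite B0.
  have Bv2 : B v2 by rewrite B1.
  have [|c [c1 c2]] := top _ Bv2.
    by move=> m; congr pair; [rewrite /= lin1K scaler0|exact: v2_wt].
  move/esym/eqP: c1; rewrite scaler_eq0 => /orP[/eqP c0|/eqP//].
  by case: v20; rewrite c2 c0 scale0r.
have NB p p' : N p -> N p' -> N (p' - p).
  by move=> Np Np'; have := NS (-1) _ _ Np Np'; rewrite scaleN1r addrC.
have uniq2 x y y' : N (x, y) -> N (x, y') -> y = y'.
  move=> Ny Ny'; apply/eqP; rewrite eq_sym -subr_eq0; apply/eqP; apply: ker2.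
  by have := NB _ _ Ny Ny'; rewrite -[(x, y') - (x, y)]/(x - x, y' - y) subrr.
have uniq1 x x' y : N (x, y) -> N (x', y) -> x = x'.
  move=> Nx Nx'; apply/eqP; rewrite eq_sym -subr_eq0; apply/eqP; apply: ker1.
  by have := NB _ _ Nx Nx'; rewrite -[(x', y) - (x, y)]/(x' - x, y - y) subrr.
have proj1 x : exists y, N (x, y).
  pose A := [set x | exists y, N (x, y)].
  have subA : submodule a1 A.
    split=> [|k u w [y Ny] [y' Ny']|i u [y Ny]|i u [y Ny]|m u [y Ny]].
    - by exists 0; exact: N0.
    - by exists (k *: y + y'); exact: (NS k _ _ Ny Ny').
    - by exists (actE a2 i y); exact: (NE i _ Ny).
    - by exists (actF a2 i y); exact: (NF i _ Ny).
    - by exists (actK a2 m y); exact: (NK m _ Ny).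
  have [A0|A1] := irr1 _ subA (fun _ _ => I).
    by have Av1 : A v1; [exists v2|case: v10; rewrite A0 in Av1].
  by have : A x by rewrite A1.
have proj2 y : N2 y -> exists x, N (x, y).
  pose B := [set y | exists x, N (x, y)].
  have subB : submodule a2 B.
    split=> [|k u w [x Nx] [x' Nx']|i u [x Nx]|i u [x Nx]|m u [x Nx]].
    - by exists 0; exact: N0.
    - by exists (k *: x + x'); exact: (NS k _ _ Nx Nx').
    - by exists (actE a1 i x); exact: (NE i _ Nx).
    - by exists (actF a1 i x); exact: (NF i _ Nx).
    - by exists (actK a1 m x); exact: (NK m _ Nx).
  have BN2 : B `<=` N2 by move=> z [x Nz]; exact: (N_N2 _ Nz).
  have [B0|B1] := irr2 _ subB BN2.
    by have Bv2 : B v2; [exists v1|case: v20; rewrite B0 in Bv2].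
  by move=> N2y; have : B y by rewrite B1.
(* The function with graph [N]; by [uniq1] and [uniq2] its properties reduce to memberships in
   [N]. *)
pose f x := projT1 (cid (proj1 x)).
have fN x : N (x, f x) by rewrite /f; case: cid.
exists f; split.
- move=> k u w; apply: (uniq2 (k *: u + w)); first exact: fN.
  exact: (NS k _ _ (fN u) (fN w)).
- by move=> x x' ff; apply: (uniq1 _ _ (f x)); [exact: fN|rewrite ff; exact: fN].
- split=> [i x|i x|m x].
  + by apply: (uniq2 (actE a1 i x)); [exact: fN|exact: (NE i _ (fN x))].
  + by apply: (uniq2 (actF a1 i x)); [exact: fN|exact: (NF i _ (fN x))].
  + by apply: (uniq2 (actK a1 m x)); [exact: fN|exact: (NK m _ (fN x))].
apply/seteqP; split=> [_ [x _ <-]|y N2y]; first exact: (N_N2 _ (fN x)).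
by have [x Nx] := proj2 y N2y; exists x => //; exact: (uniq2 x) (fN x) Nx.
Qed.

End Product.
End HighestWeightModules.

(** * Reversal of the variables *)

Section Relabelling.
Variables (K : fieldType) (I : choiceType) (h : I -> I).
Local Notation T := (freealg K I).

Definition relabel (x : T) : T := word_lin (fun w => word K (map h w)) x.

Lemma relabel_linear : linear relabel.
Proof. exact: word_lin_linear. Qed.

Lemma relabel_word w : relabel (word K w) = word K (map h w).
Proof. exact: word_lin_word. Qed.

Lemma relabelM x y : relabel (x * y) = relabel x * relabel y.
Proof.
move: x y; apply: bilinear_word_ext => [x|y|x|y|w w'].
- exact (comp_linear relabel_linear (mull_linear x)).
- exact (comp_linear relabel_linear (mulr_linear y)).
- exact (comp_linear (mull_linear (relabel x)) relabel_linear).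
- exact (comp_linear (mulr_linear (relabel y)) relabel_linear).
- by rewrite -word_cat !relabel_word map_cat word_cat.
Qed.

Lemma relabel_ideal (G H : set T) : (forall g, G g -> relabel g \in ideal H) ->
  forall x, x \in ideal G -> relabel x \in ideal H.
Proof.
move=> GH; apply: ideal_sub => [|a g b Gg].
  exact (lin_closed_preim relabel_linear (ideal_closed H)).
rewrite /= 2!relabelM; apply: Defs.idealMr; apply: idealMl; exact: GH.
Qed.

End Relabelling.

Lemma relabelK (K : fieldType) (I : choiceType) (h : I -> I) :
  involutive h -> involutive (@relabel K I h).
Proof.
move=> hK; apply: (@linear_word_ext K I _ (fun x => relabel h (relabel h x)) id) => [||w].
- exact (comp_linear (@relabel_linear K I h) (@relabel_linear K I h)).
- by [].
by rewrite !relabel_word mapK.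
Qed.

Section QuotientMorphism.
Variables (K : fieldType) (I : choiceType) (h : I -> I) (G H : set (freealg K I)).
Hypothesis hK : involutive h.
Hypothesis GH : forall g, G g -> relabel h g \in ideal H.
Hypothesis HG : forall g, H g -> relabel h g \in ideal G.

Definition quot_relabel (y : quotalg G) : quotalg H :=
  quot_proj H (relabel h (repr y)).

Lemma quot_relabel_pi x : quot_relabel (quot_proj G x) = quot_proj H (relabel h x).
Proof.
apply/quot_projP; rewrite -(linear_funB (@relabel_linear K I h)).
by apply: relabel_ideal GH _ _; apply/quot_projP; rewrite repr_proj.
Qed.

Lemma quot_relabel_add : {morph quot_relabel : x y / x - y}.
Proof.
move=> x y; rewrite -[x]repr_proj -[y]repr_proj.
rewrite -(linear_funB (@quot_proj_linear K I G)) !quot_relabel_pi.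
by rewrite (linear_funB (@relabel_linear K I h)) (linear_funB (@quot_proj_linear K I H)).
Qed.

Lemma quot_relabel_mul : monoid_morphism quot_relabel.
Proof.
split.
  rewrite -[1]/(quot_proj G 1) quot_relabel_pi -[1 in RHS]/(quot_proj H 1).
  by congr (quot_proj H _); rewrite -word_nil relabel_word.
move=> x y; rewrite -[x]repr_proj -[y]repr_proj.
rewrite -[quot_proj G _ * _]quot_projM !quot_relabel_pi relabelM.
exact: quot_projM.
Qed.

HB.instance Definition _ := GRing.isZmodMorphism.Build (quotalg G) (quotalg H)
  quot_relabel quot_relabel_add.
HB.instance Definition _ := GRing.isMonoidMorphism.Build (quotalg G) (quotalg H)
  quot_relabel quot_relabel_mul.

Lemma quot_relabel_scalable : scalable quot_relabel.
Proof.
move=> k x; rewrite -[x]repr_proj -(linear_funZ (@quot_proj_linear K I G)).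
rewrite !quot_relabel_pi (linear_funZ (@relabel_linear K I h)).
exact: linear_funZ (@quot_proj_linear K I H) _ _.
Qed.

(** The inverse is the same relabelling from H to G; [HG] makes it compatible with the ideals. *)
Lemma quot_relabel_bij : bijective quot_relabel.
Proof.
exists (fun y : quotalg H => quot_proj G (relabel h (repr y))) => y.
  rewrite -[RHS]repr_proj; apply/quot_projP.
  rewrite -[X in _ - X](relabelK hK) -(linear_funB (@relabel_linear K I h)).
  by apply: relabel_ideal HG _ _; apply/quot_projP; rewrite repr_proj.
rewrite -[RHS]repr_proj quot_relabel_pi; congr (quot_proj H _).
exact: relabelK.
Qed.

Definition quot_relabel_morphism : {rmorphism quotalg G -> quotalg H} := quot_relabel.

End QuotientMorphism.

Section ReversedPresentation.
Variables (K : fieldType) (q : K) (n : nat).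
Hypotheses (q_neq0 : q != 0) (q_inf : forall m, (0 < m)%N -> q ^+ m != 1).
Hypothesis two_neq0 : 1 + 1 != 0 :> K.
Local Notation d := n.+1.
Local Notation T := (freealg K 'I_d).
Variable c : 'M[K]_d -> 'M[K]_d.
Hypothesis c_entry : forall X (r s : 'I_d), c X r s =
  (if r == s then q else 1) * X s r + (if (r < s)%N then (q - q^-1) * X r s else 0).

Let relabel_gen2 k (a b : 'I_d) (u := gen K a * gen K b : T) (v := gen K b * gen K a : T) :
  relabel (@rev_ord d) (u - k *: v) =
  gen K (rev_ord a) * gen K (rev_ord b) - k *: (gen K (rev_ord b) * gen K (rev_ord a)).
Proof.
have genM i j : relabel (@rev_ord d) (gen K i * gen K j) =
    gen K (rev_ord i) * gen K (rev_ord j).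
  by rewrite relabelM; congr (_ * _); exact: relabel_word.
apply: etrans (linear_funB (@relabel_linear K 'I_d (@rev_ord d)) _ _) _.
have Zv := etrans (linear_funZ (@relabel_linear K 'I_d (@rev_ord d)) k v)
  (congr1 ( *:%R k) (genM b a)).
exact (congr2 (fun x y : T => x - y) (genM a b) Zv).
Qed.

Let rev_lt (i j : 'I_d) : (i < j)%N -> (rev_ord j < rev_ord i)%N.
Proof. by move=> ij; rewrite /= !subSS ltn_sub2l// (leq_trans ij)// -ltnS. Qed.

(** A name for the relations inside [qpoly_alg]; the quotient by them is [qpoly_alg] by
    conversion. *)
Definition qpoly_rels : set T :=
  [set y : T | exists i j : 'I_d,
     (i < j)%N /\ y = gen K j * gen K i - q *: (gen K i * gen K j)].

(** After reversal, x_j x_i = q^-1 x_i x_j has its smaller index first on the left; solving for the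
    other product turns q^-1 into q. *)
Lemma relabel_L2 g : (@emb2 K d @` L2 q c) g -> relabel (@rev_ord d) g \in ideal qpoly_rels.
Proof.
move=> [X XL <-]; move: X XL; apply: (L2_ind q_neq0 q_inf two_neq0 c_entry) => [|i j ij].
  exact (lin_closed_preim (comp_linear (@relabel_linear K 'I_d (@rev_ord d))
    (@emb2_linear K d)) (ideal_closed qpoly_rels)).
rewrite /= emb2_qwedge relabel_gen2.
have q'0 : q^-1 != 0 by rewrite invr_eq0.
have := sub_scale_inv (gen K (rev_ord j) * gen K (rev_ord i))
  (gen K (rev_ord i) * gen K (rev_ord j)) q'0.
rewrite invrK => ->; apply: idealZ; apply: ideal_gen.
by exists (rev_ord j), (rev_ord i); split=> //; exact: rev_lt.
Qed.

Lemma relabel_qpoly g : qpoly_rels g -> relabel (@rev_ord d) g \in ideal (@emb2 K d @` L2 q c).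
Proof.
move=> [i [j [ij ->]]]; rewrite relabel_gen2 (sub_scale_inv _ _ q_neq0).
apply: idealZ; apply: ideal_gen.
exact: (L2_rel q_neq0 q_inf two_neq0 c_entry (rev_lt ij)).
Qed.

End ReversedPresentation.

(** * The generic parameter of C(q) and the conclusion *)

Lemma poly_two_neq0 (F : numDomainType) : 1 + 1 != 0 :> {poly F}.
Proof. by rewrite -polyC1 -polyCD polyC_eq0 (Num.Theory.pnatr_eq0 _ 2). Qed.

Section GenericParameter.
Variable R : realType.

Lemma qvar_neq0 : qvar R != 0.
Proof. by rewrite /qvar tofrac_eq0 polyX_eq0. Qed.

Lemma qvar_not_root1 m : (0 < m)%N -> qvar R ^+ m != 1.
Proof.
move=> m0; rewrite /qvar -tofracXn -tofrac1 tofrac_eq.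
apply/eqP => /(congr1 (fun p : {poly _} => size p)).
by rewrite size_polyXn size_poly1 => -[m0']; rewrite m0' in m0.
Qed.

Lemma Cq_two_neq0 : 1 + 1 != 0 :> Cq R.
Proof.
by rewrite -tofrac1 -tofracD tofrac_eq0; exact: poly_two_neq0.
Qed.

End GenericParameter.

(** C(q) enters only through these three properties of [K] and [q]. The rank is written as a
    successor so that x_1, [lo] and [hi] are defined. *)
Theorem braided_sym_alg_std (K : fieldType) (q : K) (m : nat) (d := m.+1) :
  q != 0 -> (forall k, (0 < k)%N -> q ^+ k != 1) -> 1 + 1 != 0 :> K ->
  forall Theta : R_series K d, universal_R q Theta ->
  forall Rmx : 'M[K]_d -> 'M[K]_d,
    is_Rmatrix q Theta (std_action q d) (std_action q d) Rmx ->
  flat q (braiding Rmx) /\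
  (exists act : Uq_action d (braided_sym_alg q (braiding Rmx)),
    [/\ is_Uq_module q act,
        equivariant (tensor_algebra_action (std_action q d)) act (@quot_proj _ _ _) &
        forall n : nat,
          simple_of_hw q act (braided_sym_alg_comp q (braiding Rmx) n) (omega1 d *+ n) /\
          forall (W : lmodType K) (b : Uq_action d W),
            is_Uq_module q b -> simple_of_hw q b setT (omega1 d *+ n) ->
            isomorphic_to b act (braided_sym_alg_comp q (braiding Rmx) n)]) /\
  (exists2 f : {rmorphism braided_sym_alg q (braiding Rmx) -> qpoly_alg q d},
     scalable f & bijective f).
Proof.
move=> q0 q_inf two0 Theta Theta_univ Rmx RmxP; have q2 : q ^+ 2 != 1 by exact: q_inf.
have c_entry := braiding_entry q0 q_inf Theta_univ RmxP.
have G_rel := L2_rel q0 q_inf two0 c_entry.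
have G_rep := L2_rep q0 q_inf two0 c_entry.
split; first exact (braiding_flat q0 q_inf two0 c_entry).
split.
  exists (quot_action q _); split.
  - exact (quot_action_is_module q0 q2 G_rel G_rep).
  - exact (quot_proj_equiv q0 q2 G_rel G_rep).
  move=> k; have simple_k := graded_comp_simple q0 q_inf G_rel G_rep k.
  split; first exact simple_k.
  move=> W b b_mod [_ W_irr W_hw]; have [_ S_irr S_hw] := simple_k.
  exact (simple_hw_iso q0 q_inf b_mod (quot_action_is_module q0 q2 G_rel G_rep)
    W_irr W_hw S_irr S_hw).
have GH := relabel_L2 q0 q_inf two0 c_entry; have HG := relabel_qpoly q0 q_inf two0 c_entry.
exists (quot_relabel_morphism GH); first exact (quot_relabel_scalable GH).
exact (quot_relabel_bij (@rev_ordK _) GH HG).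
Qed.

Theorem lemma2p32 (R : realType) (d : nat) (d_ge1 : (1 <= d)%N)
    (Theta : R_series (Cq R) d) (Theta_univ : universal_R (qvar R) Theta)
    (Rmx : 'M[Cq R]_d -> 'M[Cq R]_d)
    (RmxP : is_Rmatrix (qvar R) Theta
              (std_action (qvar R) d) (std_action (qvar R) d) Rmx) :
  flat (qvar R) (braiding Rmx) /\
  (exists act : Uq_action d (braided_sym_alg (qvar R) (braiding Rmx)),
    [/\ is_Uq_module (qvar R) act,
        equivariant (tensor_algebra_action (std_action (qvar R) d)) act
          (@quot_proj _ _ _) &
        forall n : nat,
          simple_of_hw (qvar R) act
            (braided_sym_alg_comp (qvar R) (braiding Rmx) n)
            (omega1 d *+ n) /\
          forall (W : lmodType (Cq R)) (b : Uq_action d W),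
            is_Uq_module (qvar R) b ->
            simple_of_hw (qvar R) b setT (omega1 d *+ n) ->
            isomorphic_to b act
              (braided_sym_alg_comp (qvar R) (braiding Rmx) n)]) /\
  (exists2 f : {rmorphism braided_sym_alg (qvar R) (braiding Rmx)
                          -> qpoly_alg (qvar R) d},
     scalable f & bijective f).
Proof.
case: d d_ge1 Theta Theta_univ Rmx RmxP => [//|m] _.
exact: (braided_sym_alg_std (@qvar_neq0 R) (@qvar_not_root1 R) (Cq_two_neq0 R)).
Qed.
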